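(* Let $G$ be a countable group, let $\mathcal{G}$ be a sub-additive gauge on $G$, and let $\mu$ be a probability measure on $G$ with finite entropy $H(\mu)<\infty$ and with a finite first moment with respect to $\mathcal{G}$. Let $\tau$ be a randomized Markov stopping time for the random walk $(G,\mu)$ with finite expectation $\mathbf{E}(\tau)$. Then the probability measure $\mu_\tau$ has a finite first moment with respect to the gauge $\mathcal{G}$, and $$\ell(\mu_\tau)=\mathbf{E}(\tau)\,\ell(\mu).$$
   Context: Entropy. $H(\mu)=-\sum_{g\in G}\mu(g)\log\mu(g)$ (with $0\log 0=0$). Gauges. A gauge $\mathcal{G}=(\mathcal{G}_n)_{n\ge 0}$ on $G$ is an increasing sequence of subsets of $G$ with $G=\bigcup_n\mathcal{G}_n$. Its gauge function is $|g|=\min\{n: g\in\mathcal{G}_n\}$. The gauge is sub-additive if $|g_1g_2|\le|g_1|+|g_2|$ for all $g_1,g_2\in G$. A probability measure $\rho$ on $G$ has a finite first moment with respect to $\mathcal{G}$ if $\sum_{g}|g|\rho(g)<\infty$. Random walk and rate of escape. For a probability measure $\rho$ on $G$, the random walk $(G,\rho)$ issued from the identity $e$ has positions $x_0=e$, $x_n=h_1h_2\cdots h_n$, where $h_1,h_2,\dots$ are independent and identically $\rho$-distributed. If $\mathcal{G}$ is sub-additive and $\rho$ has a finite first moment, then the rate of escape $\ell(\rho)=\lim_{n\to\infty}|x_n|/n$ exists for almost every sample path and in $L^1$ (by Kingman's theorem), and is a constant. Randomized Markov stopping time. Let $(\Omega,\theta)$ be a Lebesgue (standard) probability space. The extended chain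 is $(\boldsymbol{x},\boldsymbol{\omega})=((e,\omega_0),(x_1,\omega_1),(x_2,\omega_2),\dots)$, where $(x_n)$ is the random walk $(G,\mu)$ from $e$ and $\omega_0,\omega_1,\dots$ are i.i.d. $\theta$-distributed and independent of $(x_n)$; equivalently, it is the Markov chain on $G\times\Omega$ with transition probabilities $\pi_{(g,\omega)}=\sum_{h}\mu(h)\,\delta_{gh}\otimes\theta$ and initial distribution $\delta_e\otimes\theta$. Let $\mathbf{P}$ be its law on the path space and $\mathbf{E}$ the expectation. A randomized Markov stopping time is a measurable function $\tau$ on the path space of the extended chain with values in $\mathbb{N}=\{1,2,\dots\}$, finite almost everywhere, such that for every $s\in\mathbb{N}$ the event $\{\tau=s\}$ belongs to the $\sigma$-algebra generated by $(x_0,\omega_0),\dots,(x_s,\omega_s)$. The transformed measure $\mu_\tau$ is the distribution of $x_\tau$: $\mu_\tau(g)=\mathbf{P}\{(\boldsymbol{x},\boldsymbol{\omega}): x_\tau=g\}$ for $g\in G$. *)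

(* Defs.v *)
From HB Require Import structures.
From mathcomp Require Import all_boot all_order all_algebra monoid.
From mathcomp Require Import all_classical all_reals all_analysis.
From mathcomp Require Import measurable_realfun.

Set Implicit Arguments.
Unset Strict Implicit.
Unset Printing Implicit Defensive.

Import Order.TTheory GRing.Theory Num.Theory.
Import numFieldNormedType.Exports.

Local Open Scope classical_set_scope.
Local Open Scope ring_scope.

Record gauge (G : Type) := Gauge {
  gauge_set :> nat -> set G ;
  gauge_increasing : forall n, gauge_set n `<=` gauge_set n.+1 ;
  gauge_cover : \bigcup_n gauge_set n = [set: G] }.

Lemma gauge_ex (G : Type) (D : gauge G) (g : G) : exists n, `[< D n g >].
Proof.
have : (\bigcup_n D n) g by rewrite gauge_cover.
by case=> n _ Dng; exists n; apply/asboolP.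
Qed.

Definition gauge_fun (G : Type) (D : gauge G) (g : G) : nat :=
  ex_minn (gauge_ex D g).

Definition subadditive_gauge (G : groupType) (D : gauge G) : Prop :=
  forall g h : G, (gauge_fun D (g * h)%g <= gauge_fun D g + gauge_fun D h)%N.

Section weights.
Context {R : realType} {G : choiceType}.
Implicit Type rho : G -> R.

Definition probability_weights rho : Prop :=
  (forall g, 0 <= rho g) /\ \esum_(g in [set: G]) (rho g)%:E = 1%:E.

(* [ln 0 = 0] in the library, so that the convention 0 log 0 = 0 holds; every
   term of the sum is nonnegative when [rho] is a probability measure. *)
Definition entropy rho : \bar R :=
  \esum_(g in [set: G]) (- (rho g * ln (rho g)))%:E.

Definition finite_first_moment (D : gauge G) rho : Prop :=
  (\esum_(g in [set: G]) ((gauge_fun D g)%:R * rho g)%:E < +oo)%E.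

End weights.

(* A group with the sigma-algebra of all its subsets. *)
Definition discrete_group (G : groupType) : Type := G.

Section discrete_group.
Variable G : groupType.
HB.instance Definition _ := Group.on (discrete_group G).
HB.instance Definition _ := isPointed.Build (discrete_group G) (1%g : G).
HB.instance Definition _ := @isMeasurable.Build default_measure_display
  (discrete_group G) discrete_measurable (@discrete_measurable0 _)
  (@discrete_measurableC _) (@discrete_measurableU _).
End discrete_group.

Definition coordinate_sets d (S : measurableType d) (I : set nat) :
    set (set (nat -> S)) :=
  \bigcup_(i in I) preimage_set_system setT (fun w : nat -> S => w i) measurable.
Arguments coordinate_sets {d} S I.

(* The space of paths in [S] with the product sigma-algebra. *)
Definition path_space d (S : measurableType d) : Type :=
  g_sigma_algebraType (coordinate_sets S setT).
Arguments path_space {d} S.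
HB.instance Definition _ d (S : measurableType d) :=
  Measurable.on (path_space S).

(* The sigma-algebra generated by the coordinates with index at most [s]. *)
Definition path_sigma_algebra d (S : measurableType d) (s : nat) :
    set (set (path_space S)) :=
  <<s coordinate_sets S [set i | (i <= s)%N] >>.

Section random_walk.
Context {R : realType} {G : groupType}.
Implicit Type rho : G -> R.

(* [Q] is the law of x_n = h_1 ... h_n with i.i.d. [rho]-distributed
   increments: x_0 = e, and the increments x_i^-1 x_{i+1} are independent with
   distribution [rho]. *)
Definition random_walk_law rho
    (Q : probability (path_space (discrete_group G)) R) : Prop :=
  forall (n : nat) (h : nat -> G),
    Q [set x | x 0%N = 1%g /\
               forall i, (i < n)%N -> ((x i)^-1 * x i.+1)%g = h i] =
    (\prod_(i < n) rho (h i))%:E.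

Definition escape_rate_law (D : gauge G) rho (l : R) : Prop :=
  forall Q : probability (path_space (discrete_group G)) R,
    random_walk_law rho Q ->
    {ae Q, forall x, (gauge_fun D (x n))%:R / n%:R @[n --> \oo] --> l} /\
    (\int[Q]_x (`|(gauge_fun D (x n))%:R / n%:R - l|)%:E)%E @[n --> \oo]
      --> 0%E.

(* The constant limit of |x_n|/n; the default value 0 is only taken when there
   is no such constant, which Kingman's theorem rules out for a sub-additive
   gauge and a probability measure with a finite first moment. *)
Definition escape_rate (D : gauge G) rho : R :=
  xget 0 [set l | escape_rate_law D rho l].

End random_walk.

(* [theta] is isomorphic mod 0, through [f], to the measure on the line made of
   Lebesgue measure on [0, a] and of atoms of mass [p n] at the points -(n+1).
   The last clause says that the inverse of [f] is measurable with respect to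
   the completion of the image measure, so that [theta] itself may or may not
   be complete. *)
Definition lebesgue_space {R : realType} d (Omega : measurableType d)
    (theta : probability Omega R) : Prop :=
  exists (a : R) (p : nat -> R) (f : Omega -> measurableTypeR R)
         (Omega0 : set Omega),
    [/\ 0 <= a /\ (forall n, 0 <= p n),
        measurable_fun setT f,
        (forall B, measurable B ->
           theta (f @^-1` B) =
           (lebesgue_measure (B `&` `[0%R, a]) +
            \sum_(0 <= n <oo) (p n)%:E * @dirac _ (measurableTypeR R) (- n.+1%:R)%R R B)%E),
        [/\ measurable Omega0, theta Omega0 = 1%E & set_inj Omega0 f] &
        (forall A, measurable A -> exists B1 B2,
           [/\ measurable B1, measurable B2,
               B1 `<=` f @` (A `&` Omega0), f @` (A `&` Omega0) `<=` B2 &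
               theta (f @^-1` (B2 `\` B1)) = 0%E])].

Section stopping_time.
Context {R : realType} {G : groupType} {d : measure_display}
  {Omega : measurableType d}.

Definition extended_path_space :=
  path_space (discrete_group G * Omega)%type.

Implicit Types (mu : G -> R) (theta : probability Omega R)
  (P : probability extended_path_space R) (tau : extended_path_space -> \bar R).

(* [P] is the law of the extended chain ((x_0, w_0), (x_1, w_1), ...): x_0 = e,
   the increments of x are i.i.d. with distribution [mu], the w_i are i.i.d.
   with distribution [theta], and the two sequences are independent. *)
Definition extended_chain_law mu theta P : Prop :=
  forall (n : nat) (h : nat -> G) (A : nat -> set Omega),
    (forall i, measurable (A i)) ->
    P [set w | (w 0%N).1 = 1%g /\
               forall i, (i < n)%N ->
                 (((w i).1)^-1 * (w i.+1).1)%g = h i /\ A i (w i).2] =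
    ((\prod_(i < n) mu (h i)) * \prod_(i < n) fine (theta (A i)))%:E.

(* The value +oo is allowed on a null set. *)
Definition randomized_stopping_time P tau : Prop :=
  [/\ measurable_fun setT tau,
      (forall w, tau w = +oo%E \/
                 exists2 s : nat, (0 < s)%N & tau w = s%:R%:E),
      {ae P, forall w, (tau w < +oo)%E} &
      (forall s : nat, (0 < s)%N ->
         path_sigma_algebra s [set w | tau w = s%:R%:E])].

Definition stopping_expectation P tau : \bar R := (\int[P]_w tau w)%E.

Definition transformed_measure P tau (g : G) : R :=
  fine (P [set w | exists2 s : nat, tau w = s%:R%:E & (w s).1 = g]).

End stopping_time.
Arguments extended_path_space : clear implicits.
Arguments extended_path_space G {d} Omega.

(* Main.v *)
(* A random walk on G with law mu_tau can be realised inside the random walk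
   with law mu: run the stopping procedure repeatedly, each time restarting from
   the current position with fresh auxiliary randomness. If T_n is the sum of
   the first n stopping times, the n-th position y_n of the mu_tau-walk is
   x_(T_n). The stopping times are i.i.d., so T_n / n tends to E(tau), and
   |y_n| / n = (|x_(T_n)| / T_n) (T_n / n) tends to l(mu) E(tau) almost surely.
   Wald's inequality gives the first moment of mu_tau, so that l(mu_tau) exists
   and is the limit of |y_n| / n.

   Both the law of large numbers and the existence of the rates of escape come
   from Kingman's theorem for an ergodic transformation, proved by the covering
   argument of Katznelson and Weiss: if liminf f_n / n < c, then long orbit
   segments are covered by blocks on which f_k <= k c, up to a set of small
   density, whose contribution is a Birkhoff average. *)

Require Import Defs.
From HB Require Import structures.
From mathcomp Require Import all_boot all_order all_algebra monoid.
From mathcomp Require Import all_classical all_reals all_analysis.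
From mathcomp Require Import measurable_realfun.
From mathcomp Require Import zify lra.

Set Implicit Arguments.
Unset Strict Implicit.
Unset Printing Implicit Defensive.

Import Order.TTheory GRing.Theory Num.Theory.
Import numFieldNormedType.Exports.

Local Open Scope classical_set_scope.
Local Open Scope ring_scope.

(** The obstacle is independence at a restart. The event [tau = s] may depend on omega_s, and the
    procedure restarted at time s would naturally begin with that same omega_s, so that successive
    stopping times would be dependent. The argument therefore runs on a richer i.i.d. sequence of
    sources, each carrying a spare auxiliary variable, and the chain rebuilt from the sources is
    shown to have law [P] again. The positions of a walk are not stationary, so ergodic arguments
    are made on increments, where the shift is ergodic by the zero-one law, and carried over to
    positions afterwards. Infinite values of [tau] are sent to 0, which leaves a natural number that
    is positive almost surely. The constant in Kingman's theorem is taken to be the almost sure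
    value of liminf f_n / n, not the limit of the means. Convergence in mean is recovered from f_n
    >= 0 and an upper bound on the means. Since both rates of escape are almost sure constants, they
    can be compared along one sample path. *)

Section change_of_variables.
Context d d' (X : measurableType d) (Y : measurableType d') (R : realType).
Variables (mu : {measure set X -> \bar R}) (nu : {measure set Y -> \bar R}).
Variable phi : X -> Y.
Hypothesis mphi : measurable_fun setT phi.
Hypothesis image_phi : forall A, measurable A -> mu (phi @^-1` A) = nu A.

Lemma ge0_integral_image (g : Y -> \bar R) :
  measurable_fun setT g -> (forall y, 0 <= g y)%E ->
  (\int[mu]_x g (phi x) = \int[nu]_y g y)%E.
Proof.
move=> mg g0.
have := ge0_integral_pushforward mphi mu measurableT mg (fun x _ => g0 x).
rewrite preimage_setT => <-.
by apply: eq_measure_integral => A mA _; exact: image_phi.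
Qed.

Lemma integrable_image (g : Y -> R) : nu.-integrable setT (EFin \o g) ->
  mu.-integrable setT (EFin \o (g \o phi)).
Proof.
move=> /integrableP[mg gfin]; apply/integrableP; split.
  exact: (measurableT_comp mg mphi).
rewrite (ge0_integral_image (g := fun x => `|(EFin \o g) x|%E))//.
exact: measurableT_comp.
Qed.

Lemma integral_image (g : Y -> R) : nu.-integrable setT (EFin \o g) ->
  (\int[mu]_x (g (phi x))%:E = \int[nu]_y (g y)%:E)%E.
Proof.
move=> ig; have /integrableP[mg _] := ig.
have h := @integral_pushforward _ _ _ _ _ _ mphi mu setT (EFin \o g) mg.
rewrite preimage_setT in h; rewrite -h//; last exact: integrable_image.
by apply: eq_measure_integral => A mA _; exact: image_phi.
Qed.

Lemma ae_image (Q : Y -> Prop) :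
  {ae nu, forall y, Q y} -> {ae mu, forall x, Q (phi x)}.
Proof.
move=> [N [mN N0 sub]]; exists (phi @^-1` N); split => /=.
- by rewrite -[X in measurable X]setTI; exact: mphi.
- by rewrite image_phi.
- by move=> x /sub.
Qed.

End change_of_variables.

(** * Kingman's subadditive ergodic theorem *)

Lemma subadditive_sum (R : realType) (X : Type) (S : X -> X)
    (f : nat -> X -> R) (u : X -> R) :
  (forall m n x, (0 < m)%N -> (0 < n)%N ->
    f (m + n)%N x <= f m x + f n (iter m S x)) ->
  (forall x, f 1%N x <= u x) ->
  forall n x, (0 < n)%N -> f n x <= \sum_(0 <= i < n) u (iter i S x).
Proof.
move=> fsub f1 [//|n] x _; elim: n x => [|n IH] x; first by rewrite big_nat1.
rewrite -(addn1 n.+1) (le_trans (fsub _ _ _ _ _))//.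
by rewrite addn1 big_nat_recr//= lerD.
Qed.

(** The bad set of the covering argument. As N grows it shrinks to the points where every f_k with k
    > 0 is positive, a null set in the applications. *)
Definition positive_upto (R : realType) (X : Type) (f : nat -> X -> R) (N : nat) : set X :=
  [set x | forall k, (0 < k <= N)%N -> 0 < f k x].

(* Cover the orbit segment of length [n] greedily: at a point of
   [positive_upto f N] take one step and pay [u], otherwise take a block of at
   most [N] steps over which [f] is nonpositive; the last block may overshoot. *)
Lemma subadditive_cover (R : realType) (X : Type) (S : X -> X)
    (f : nat -> X -> R) (u : X -> R) (N : nat) :
  (forall m n x, (0 < m)%N -> (0 < n)%N ->
    f (m + n)%N x <= f m x + f n (iter m S x)) ->
  (forall x, f 1%N x <= u x) -> (forall x, 0 <= u x) -> (0 < N)%N ->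
  forall n x, (0 < n)%N ->
  f n x <= \sum_(0 <= i < n) (u (iter i S x) * \1_(positive_upto f N) (iter i S x))
         + \sum_(n - N <= i < n) u (iter i S x).
Proof.
move=> fsub f1 u0 N0; elim/ltn_ind => n IH x n0.
have w0 y : 0 <= u y * \1_(positive_upto f N) y by rewrite mulr_ge0.
(* For [n <= N] truncated subtraction makes the second sum run over the whole segment. *)
have [nN|Nn] := leqP n N.
  move: nN; rewrite -subn_eq0 => /eqP ->.
  by rewrite ler_wpDl ?sumr_ge0//; exact: subadditive_sum.
have [k [/andP[k0 kN] fk]] : exists k, (0 < k <= N)%N /\
    f k x <= \sum_(0 <= i < k) (u (iter i S x) * \1_(positive_upto f N) (iter i S x)).
  have [xB|] := pselect (positive_upto f N x).
    exists 1%N; rewrite N0 big_nat1 /= indicE mem_set// mulr1; split => //.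
  move/existsNP => [k /not_implyP[kN /negP]]; rewrite -leNgt => fk0.
  by exists k; split => //; rewrite (le_trans fk0)// sumr_ge0.
have kn : (k < n)%N by exact: leq_ltn_trans Nn.
rewrite -{1}(subnKC (ltnW kn)) (le_trans (fsub _ _ _ _ _))// ?subn_gt0//.
have nk : (n - k < n)%N by lia.
have nk0 : (0 < n - k)%N by lia.
have := IH (n - k)%N nk (iter k S x) nk0.
have itk i : iter i S (iter k S x) = iter (i + k) S x by rewrite iterD.
under eq_bigr do rewrite itk.
under [X in _ <= _ + X -> _]eq_bigr do rewrite itk.
rewrite -(big_addn 0 n k predT (fun i => u (iter i S x) * \1_(positive_upto f N) (iter i S x))).
rewrite -[X in \sum_(X <= _ < n - k) _](addnK k (n - k - N)%N).
rewrite add0n.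
have -> : \sum_(n - k - N + k - k <= i < n - k) u (iter (i + k) S x) =
   \sum_(n - k - N + k <= i < n) u (iter i S x).
  by rewrite addnK [RHS]big_addn.
move=> H; apply: (le_trans (lerD fk H)).
rewrite addrA -big_cat_nat//=; last exact: ltnW.
rewrite lerD2l.
(* With truncated subtraction [n - k - N + k] is the maximum of [n - N] and [k], so the tail left by
   the recursive call is contained in the allowed one. *)
rewrite [leRHS](@big_cat_nat _ _ _ (n - k - N + k)%N)/=; [|lia|lia].
by rewrite ler_wpDl// sumr_ge0.
Qed.

(** * Ergodic measure-preserving maps: the theorems of Birkhoff and Kingman *)

Section ergodic.
Context d (X : measurableType d) (R : realType) (P : probability X R).
Variable S : X -> X.
Hypothesis mS : measurable_fun setT S.
Hypothesis PS : forall A, measurable A -> P (S @^-1` A) = P A.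
Hypothesis S_erg :
  forall A, measurable A -> S @^-1` A = A -> P A = 0%E \/ P A = 1%E.

Lemma measurable_iter i : measurable_fun setT (iter i S).
Proof.
elim: i => [|i IH]; first exact: measurable_id.
exact: (measurableT_comp mS IH).
Qed.

Lemma measurable_preimage (A : set X) : measurable A -> measurable (S @^-1` A).
Proof. by move=> mA; rewrite -[X in measurable X]setTI; exact: mS. Qed.

Lemma measurable_iter_preimage i (A : set X) :
  measurable A -> measurable (iter i S @^-1` A).
Proof. by move=> mA; rewrite -[X in measurable X]setTI; exact: measurable_iter. Qed.

Lemma iter_measure_preserving i (A : set X) :
  measurable A -> P (iter i S @^-1` A) = P A.
Proof.
elim: i A => [//|i IH] A mA.
have -> : iter i.+1 S @^-1` A = iter i S @^-1` (S @^-1` A) by [].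
by rewrite IH ?PS//; exact: measurable_preimage.
Qed.

Lemma integral_orbit_sum (g : X -> R) (m n : nat) (a : R) :
  P.-integrable setT (EFin \o g) -> (\int[P]_x (g x)%:E = a%:E)%E ->
  P.-integrable setT (EFin \o (fun x => \sum_(m <= i < n) g (iter i S x))) /\
  (\int[P]_x (\sum_(m <= i < n) g (iter i S x))%:E = ((n - m)%:R * a)%:E)%E.
Proof.
move=> ig ga.
have E : EFin \o (fun x => \sum_(m <= i < n) g (iter i S x)) =
   (fun x => \sum_(m <= i < n) (EFin \o (g \o iter i S)) x)%E.
  by apply/funext => x /=; rewrite sumEFin.
split; first by rewrite E; apply: integrable_sum => // i _; exact: (integrable_image (measurable_iter i) (@iter_measure_preserving i)).
under eq_integral do rewrite -sumEFin.
rewrite (integral_sum measurableT (f := fun i x => (g (iter i S x))%:E))//; last first.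
  by move=> i; exact: (integrable_image (measurable_iter i) (@iter_measure_preserving i)).
under eq_bigr do rewrite (integral_image (measurable_iter _) (@iter_measure_preserving _))// ga.
by rewrite sumEFin sumr_const_nat mulr_natl.
Qed.

(** Ergodicity only speaks of strictly invariant sets. The iterated preimages of A decrease and all
    have measure [P A], so their intersection B is invariant and still has measure [P A]. *)
Lemma subinvariant_01 (A : set X) : measurable A -> S @^-1` A `<=` A ->
  P A = 0%E \/ P A = 1%E.
Proof.
move=> mA SA; pose B := \bigcap_n (iter n S @^-1` A).
have mF n : measurable (iter n S @^-1` A) by exact: measurable_iter_preimage.
have mB : measurable B by exact: bigcapT_measurable.
have PB : P B = P A.
  have : (P \o (fun n => iter n S @^-1` A)) x @[x --> \oo] --> P B.
    apply: nonincreasing_cvg_mu => //.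
      by rewrite /= (le_lt_trans (probability_le1 _ _))// ltry.
    apply/nonincreasing_seqP => n; apply/subsetPset => x /=; exact: SA.
  have -> : P \o (fun n => iter n S @^-1` A) = cst (P A).
    by apply/funext => n /=; exact: iter_measure_preserving.
  by move/cvg_lim => <-//; rewrite lim_cst.
rewrite -PB; apply: S_erg => //; apply/seteqP; split => x xB.
  move=> [|n] _ /=; first by apply: SA; exact: (xB 0%N).
  by rewrite -iterS iterSr; exact: xB.
by move=> n _ /=; rewrite -iterSr; exact: xB.
Qed.

Lemma measurable_le_set (f : X -> R) (c : R) : measurable_fun setT f ->
  measurable [set x | f x <= c].
Proof.
move=> mf; rewrite -[X in measurable X]setTI.
have -> : [set x | f x <= c] = f @^-1` `]-oo, c].
  by apply/seteqP; split => x; rewrite /= in_itv.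
exact: mf.
Qed.

Lemma measurable_positive_upto (f : nat -> X -> R) (N : nat) :
  (forall n, measurable_fun setT (f n)) -> measurable (positive_upto f N).
Proof.
move=> mf.
have -> : positive_upto f N = \bigcap_k
    (if (0 < k <= N)%N then ~` [set x | f k x <= 0] else setT).
  apply/seteqP; split => x H k.
    by move=> _; case: ifPn => // kN; apply/negP; rewrite -ltNge; exact: H.
  by move=> kN; have := H k I; rewrite kN => /negP; rewrite -ltNge.
apply: bigcapT_measurable => k; case: ifPn => // _.
by apply: measurableC; exact: measurable_le_set.
Qed.

(** Dominated convergence with bound |u|: at a point where f_k <= 0 for some k > 0, the indicator
    vanishes as soon as N >= k. *)
Lemma integral_positive_upto (f : nat -> X -> R) (u : X -> R) :
  (forall n, measurable_fun setT (f n)) ->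
  P.-integrable setT (EFin \o u) ->
  {ae P, forall x, exists2 k, (0 < k)%N & f k x <= 0} ->
  (\int[P]_x (u x * \1_(positive_upto f N) x)%:E)%E @[N --> \oo] --> 0%E.
Proof.
move=> mf iu hit; have /integrableP[/measurable_EFinP mu _] := iu.
have h := @dominated_convergence _ _ _ P setT measurableT
  (fun N x => (u x * \1_(positive_upto f N) x)%:E) (cst 0%E) (fun x => `|(u x)%:E|%E).
have [|||||_ _] := h.
- move=> N; apply/measurable_EFinP; apply: measurable_funM => //.
  by apply: measurable_indic; exact: measurable_positive_upto.
- exact: measurable_cst.
- apply: filterS hit => x [k k0 fk] _.
  apply: cvg_near_cst; near=> N; rewrite indicE memNset ?mulr0//.
  move=> /(_ k); rewrite k0 /= => H.
  have : (k <= N)%N by near: N; exact: nbhs_infty_ge.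
  by move/H; rewrite ltNge fk.
- exact: integrable_abse.
- apply: aeW => x N _; rewrite !abse_EFin lee_fin normrM ler_piMr//.
  by rewrite indicE; case: (_ \in _); rewrite ?normr1// normr0.
by rewrite integral_cst// mul0e.
Unshelve. all: by end_near.
Qed.
(** The event liminf f_n / n <= c, written with countable quantifiers to make its measurability
    visible. *)
Definition liminf_le (f : nat -> X -> R) (c : R) : set X :=
  [set x | forall k N, exists2 n, (N <= n)%N && (0 < n)%N &
     f n x <= n%:R * (c + k.+1%:R^-1)].

Lemma measurable_liminf_le (f : nat -> X -> R) (c : R) :
  (forall n, measurable_fun setT (f n)) -> measurable (liminf_le f c).
Proof.
move=> mf.
have -> : liminf_le f c = \bigcap_k \bigcap_N \bigcup_n
    (if (N <= n)%N && (0 < n)%N then [set x | f n x <= n%:R * (c + k.+1%:R^-1)] else set0).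
  apply/seteqP; split => x H.
    by move=> k _ N _; have [n nN fn] := H k N; exists n => //; rewrite nN.
  move=> k N; have [n _] := H k I N I.
  by case: ifPn => // nN fn; exists n.
apply: bigcapT_measurable => k; apply: bigcapT_measurable => N.
apply: bigcup_measurable => n _; case: ifPn => // _.
exact: measurable_le_set.
Qed.

(** Passing from S x to x shifts the index by one and costs at most v x. For large n this cost is
    absorbed by relaxing the tolerance from 1/(k+2) to 1/(k+1): the gap e satisfies n e >= v x - c,
    which is what the choice of the lower bound on n ensures. *)
Lemma liminf_le_subinvariant (f : nat -> X -> R) (v : X -> R) (c : R) :
  (forall n x, (0 < n)%N -> f n.+1 x <= v x + f n (S x)) ->
  S @^-1` (liminf_le f c) `<=` liminf_le f c.
Proof.
move=> fS x /= H k N.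
pose e : R := k.+1%:R^-1 - k.+2%:R^-1.
have e0 : 0 < e by rewrite subr_gt0 ltf_pV2 ?posrE ?ltr0n// ltr_nat.
have [n /andP[nN n0] fn] := H k.+1 (maxn N (Num.bound (`|v x - c| / e))).
exists n.+1.
  by rewrite /= andbT (leq_trans _ (leqnSn n))// (leq_trans _ nN)// leq_maxl.
have ne : v x - c <= n%:R * e.
  rewrite (le_trans (ler_norm _))// -ler_pdivrMr//.
  have := archi_boundP (divr_ge0 (normr_ge0 (v x - c)) (ltW e0)).
  move/ltW/le_trans; apply; rewrite ler_nat (leq_trans _ nN)// leq_maxr//.
have k0 : 0 <= k.+1%:R^-1 :> R by rewrite invr_ge0.
have nS : n.+1%:R = n%:R + 1 :> R by rewrite natr1.
have := fS n x n0; move: ne fn k0; rewrite /e nS.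
move: (_.+1%:R^-1) (_.+2%:R^-1) => r1 r2; nra.
Qed.

Lemma liminf_le_01 (f : nat -> X -> R) (v : X -> R) (c : R) :
  (forall n, measurable_fun setT (f n)) ->
  (forall n x, (0 < n)%N -> f n.+1 x <= v x + f n (S x)) ->
  P (liminf_le f c) = 0%E \/ P (liminf_le f c) = 1%E.
Proof.
move=> mf fS; apply: subinvariant_01; first exact: measurable_liminf_le.
exact: liminf_le_subinvariant fS.
Qed.

Lemma ae_probability1 (A : set X) : measurable A -> P A = 1%E ->
  {ae P, forall x, A x}.
Proof.
move=> mA PA; exists (~` A); split => //; first exact: measurableC.
by rewrite probability_setC// PA subee.
Qed.

Lemma ae_probability0 (A : set X) : measurable A -> P A = 0%E ->
  {ae P, forall x, ~ A x}.
Proof.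
by move=> mA PA; exists A; split => // x /= /contrapT.
Qed.

Lemma probability1_ae (A : set X) : measurable A -> {ae P, forall x, A x} ->
  P A = 1%E.
Proof.
move=> mA [N [mN N0 sub]].
have : (P (~` A) <= 0)%E.
  by rewrite -N0 le_measure ?inE//; exact: measurableC.
rewrite probability_setC// => PA.
apply/eqP; rewrite eq_le probability_le1//=.
by rewrite -sube_le0.
Qed.

Definition subadditive_cocycle (f : nat -> X -> R) := forall m n x,
  (0 < m)%N -> (0 < n)%N -> f (m + n)%N x <= f m x + f n (iter m S x).

(** The covering is applied to f_n - n (c + e), which is nonpositive for some n > 0 almost surely
    when liminf f_n / n <= c. The function g is u restricted to the bad set, and N is chosen so
    large that its integral is at most e. *)
Lemma cover_liminf (f : nat -> X -> R) (c e : R) :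
  subadditive_cocycle f -> (forall n, measurable_fun setT (f n)) ->
  P.-integrable setT (EFin \o f 1%N) ->
  P (liminf_le f c) = 1%E -> 0 < e ->
  exists (N : nat) (u g : X -> R),
  [/\ P.-integrable setT (EFin \o u), P.-integrable setT (EFin \o g),
    (forall x, 0 <= u x) /\ (forall x, 0 <= g x),
    (\int[P]_x (g x)%:E <= e%:E)%E &
    forall n x, (0 < n)%N ->
      f n x <= n%:R * (c + e) + \sum_(0 <= i < n) g (iter i S x)
             + \sum_(n - N <= i < n) u (iter i S x)].
Proof.
move=> fsub mf if1 Pc e0.
pose f' n x := f n x - n%:R * (c + e).
pose u (x : X) : R := `|f 1%N x| + `|c + e|.
have mf' n : measurable_fun setT (f' n).
  by apply: measurable_funB => //; exact: measurable_cst.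
have iu : P.-integrable setT (EFin \o u).
  rewrite (_ : _ \o _ = (fun x => `|(EFin \o f 1%N) x| + (EFin \o cst `|c + e|%R) x)%E)//.
  apply: integrableD => //; first exact: integrable_abse.
  exact: finite_measure_integrable_cst.
have u0 x : 0 <= u x by rewrite addr_ge0.
have f'1 x : f' 1%N x <= u x.
  by rewrite /f' /u mul1r lerD ?ler_norm// -normrN ler_norm.
have f'sub : subadditive_cocycle f'.
  move=> m n x m0 n0; have := fsub m n x m0 n0; rewrite /f' natrD; lra.
have hit : {ae P, forall x, exists2 k, (0 < k)%N & f' k x <= 0}.
  have aePc := ae_probability1 (measurable_liminf_le c mf) Pc.
  apply: filterS aePc => x H.
  have [n /andP[_ n0] fn] := H (Num.bound e^-1) 0%N.
  exists n => //; rewrite /f' subr_le0 (le_trans fn)// ler_wpM2l// lerD2l.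
  rewrite invf_ple ?posrE//; apply: ltW.
  have := archi_boundP (ltW (_ : 0 < e^-1)); rewrite invr_gt0 => /(_ e0).
  by move/lt_le_trans; apply; rewrite ler_nat.
have := integral_positive_upto mf' iu hit.
move=> /fine_cvgP[finN] /cvgrPdist_le /(_ e e0) leN.
near \oo => N.
have N0 : (0 < N)%N by near: N; exact: nbhs_infty_gt.
have finI : (\int[P]_x (u x * \1_(positive_upto f' N) x)%:E)%E \is a fin_num.
  by near: N.
have leI : `|0 - fine (\int[P]_x (u x * \1_(positive_upto f' N) x)%:E)%E| <= e.
  by near: N.
pose g x := u x * \1_(positive_upto f' N) x.
have g0 x : 0 <= g x by rewrite mulr_ge0.
have mg : measurable_fun setT g.
  apply: measurable_funM; first by case/integrableP : iu => /measurable_EFinP.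
  by apply: measurable_indic; exact: measurable_positive_upto.
exists N, u, g; split => //.
- apply: le_integrable iu => //; first exact/measurable_EFinP.
  move=> x _ /=; rewrite lee_fin normrM ler_piMr// indicE.
  by rewrite normr_nat lern1 leq_b1.
- by rewrite -(fineK finI) lee_fin; move: leI; rewrite sub0r normrN; apply: le_trans; exact: ler_norm.
- move=> n x n0.
  have := subadditive_cover f'sub f'1 u0 N0 x n0.
  rewrite {1}/f'; rewrite /g; lra.
Unshelve. all: by end_near.
Qed.

Lemma expectation_const (r : R) : (\int[P]_x r%:E = r%:E)%E.
Proof.
rewrite integral_cst// -[RHS]mule1; congr (_ * _)%E; exact: probability_setT.
Qed.

(** The last sum has at most N terms, each of mean b, so it costs at most N b whatever n is. *)
Lemma integral_cover (n N : nat) (a e b : R) (u g : X -> R) :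
  P.-integrable setT (EFin \o u) -> P.-integrable setT (EFin \o g) ->
  (\int[P]_x (g x)%:E <= e%:E)%E -> (\int[P]_x (u x)%:E = b%:E)%E ->
  (forall x, 0 <= u x) -> (forall x, 0 <= g x) ->
  let h x := n%:R * a + \sum_(0 <= i < n) g (iter i S x)
             + \sum_(n - N <= i < n) u (iter i S x) in
  P.-integrable setT (EFin \o h) /\
  (\int[P]_x (h x)%:E <= (n%:R * (a + e) + N%:R * b)%:E)%E.
Proof.
move=> iu ig ge ub u0 g0 h.
have finI : (\int[P]_x (g x)%:E)%E \is a fin_num by exact: integrable_fin_num.
have [i1 E1] := integral_orbit_sum 0 n ig (esym (fineK finI)).
have [i2 E2] := integral_orbit_sum (n - N) n iu ub.
have i0 : P.-integrable setT (EFin \o cst (n%:R * a)).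
  exact: finite_measure_integrable_cst.
have i01 := integrableD measurableT i0 i1.
split; first exact: (integrableD measurableT i01 i2).
have -> : (\int[P]_x (h x)%:E = (n%:R * a)%:E + ((n - 0)%:R * fine (\int[P]_x (g x)%:E)%E)%:E
    + ((n - (n - N))%:R * b)%:E)%E.
  rewrite -E1 -E2 -[X in (X + _ + _)%E](_ : (\int[P]_x (cst (n%:R * a)%:E x))%E = _); last first.
    exact: expectation_const.
  by rewrite -integralD// -integralD.
have b0 : 0 <= b by rewrite -lee_fin -ub; apply: integral_ge0 => x _; rewrite lee_fin.
rewrite -!EFinD lee_fin mulrDr subn0 lerD// ?lerD2l.
  by rewrite ler_wpM2l// -lee_fin fineK.
by rewrite ler_wpM2r// ler_nat; lia.
Qed.
(** The covering errors enter only through their integrals, so no pointwise ergodic theorem is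
    involved and Birkhoff's theorem can be deduced from this bound. Half of e goes to the slack in
    c, half to the integral of g. *)
Lemma subadditive_mean_bound (f : nat -> X -> R) (c e : R) :
  subadditive_cocycle f -> (forall n, measurable_fun setT (f n)) ->
  (forall n, (0 < n)%N -> P.-integrable setT (EFin \o f n)) ->
  P (liminf_le f c) = 1%E -> 0 < e ->
  exists C : R, forall n, (0 < n)%N ->
    (\int[P]_x (f n x)%:E <= (n%:R * (c + e) + C)%:E)%E.
Proof.
move=> fsub mf intf Pc e0.
have e20 : 0 < e / 2 by rewrite divr_gt0.
have [N [u [g [iu ig [u0 g0] ge fle]]]] := cover_liminf fsub mf (intf 1%N isT) Pc e20.
have finu : (\int[P]_x (u x)%:E)%E \is a fin_num by exact: integrable_fin_num.
exists (N%:R * fine (\int[P]_x (u x)%:E)%E) => n n0.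
have [ih hle] := integral_cover n N (c + e / 2) iu ig ge (esym (fineK finu)) u0 g0.
have -> : c + e = c + e / 2 + e / 2 by rewrite -addrA -splitr.
apply: le_trans hle; apply: le_integral => //; first exact: intf.
by move=> x _; rewrite lee_fin; exact: fle.
Qed.

Lemma archi_mul_lt (a b : R) : 0 < a -> exists2 n, (0 < n)%N & b < n%:R * a.
Proof.
move=> a0; exists (Num.bound (`|b| / a)).+1 => //.
rewrite -ltr_pdivrMr//; apply: (@le_lt_trans _ _ (`|b| / a)).
  by rewrite ler_wpM2r ?ler_norm// invr_ge0 ltW.
rewrite (lt_le_trans (archi_boundP _))// ?ler_nat//.
by rewrite divr_ge0// ltW.
Qed.

(** If c < a, the mean bound with e = (a - c) / 2 gives n (a - c) / 2 <= C for every n > 0. *)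
Lemma liminf_le_mean (f : nat -> X -> R) (c a : R) :
  subadditive_cocycle f -> (forall n, measurable_fun setT (f n)) ->
  (forall n, (0 < n)%N -> P.-integrable setT (EFin \o f n)) ->
  (forall n, (0 < n)%N -> (\int[P]_x (f n x)%:E = (n%:R * a)%:E)%E) ->
  P (liminf_le f c) = 1%E -> a <= c.
Proof.
move=> fsub mf intf fa Pc; rewrite leNgt; apply/negP => ca.
have e0 : 0 < (a - c) / 2 by rewrite divr_gt0// subr_gt0.
have [C H] := subadditive_mean_bound fsub mf intf Pc e0.
have [n n0] := archi_mul_lt C e0.
have := H n n0; rewrite fa// lee_fin; lra.
Qed.

Lemma liminf_le_ge (f : nat -> X -> R) (a : R) (x : X) :
  (forall j, ~ liminf_le f (a - j.+1%:R^-1) x) ->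
  forall e, 0 < e -> \forall n \near \oo, n%:R * (a - e) < f n x.
Proof.
move=> H e e0.
have [j j0 je] := archi_mul_lt 1 e0.
have /existsNP[k /existsNP[N kN]] := H j.-1.
near=> n; rewrite ltNge; apply/negP => fn; apply: kN; exists n.
  apply/andP; split; near: n; [exact: nbhs_infty_ge|exact: nbhs_infty_gt].
rewrite (le_trans fn)// ler_wpM2l// -addrA lerD2l.
rewrite (prednK j0) -[leLHS]addr0 lerD// ?invr_ge0// lerN2.
by rewrite invf_ple ?posrE ?ltr0n// -[e^-1]mul1r ler_pdivrMr// ltW.
Unshelve. all: by end_near.
Qed.

Lemma ae_liminf_ge (f : nat -> X -> R) (a : R) :
  (forall n, measurable_fun setT (f n)) ->
  (forall j, P (liminf_le f (a - j.+1%:R^-1)) = 0%E) ->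
  {ae P, forall x, forall e, 0 < e -> \forall n \near \oo, n%:R * (a - e) < f n x}.
Proof.
move=> mf H.
have /ae_foralln : forall j, {ae P, forall x, ~ liminf_le f (a - j.+1%:R^-1) x}.
  by move=> j; apply: ae_probability0 => //; exact: measurable_liminf_le.
by apply: filterS => x /liminf_le_ge.
Qed.

Lemma subadditive_cocycle_step (f : nat -> X -> R) : subadditive_cocycle f ->
  forall n x, (0 < n)%N -> f n.+1 x <= f 1%N x + f n (S x).
Proof. by move=> fsub n x n0; rewrite -add1n; exact: fsub. Qed.

Definition orbit_sum (g : X -> R) (n : nat) (x : X) := \sum_(0 <= i < n) g (iter i S x).

Lemma orbit_sumD (g : X -> R) m n x :
  orbit_sum g (m + n) x = orbit_sum g m x + orbit_sum g n (iter m S x).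
Proof.
rewrite /orbit_sum (@big_cat_nat _ _ _ m)//= ?leq_addr//; congr (_ + _).
rewrite -{1}[m]add0n big_addn addKn.
by apply: eq_bigr => i _; rewrite iterD.
Qed.

(** By the zero-one law the event liminf <= a - 1/(j+1) has probability 0 or 1, and probability 1
    would contradict the mean, which is exactly n a. *)
Lemma ae_orbit_sum_ge (g : X -> R) (a : R) :
  P.-integrable setT (EFin \o g) -> (\int[P]_x (g x)%:E = a%:E)%E ->
  {ae P, forall x, forall e, 0 < e ->
    \forall n \near \oo, n%:R * (a - e) < orbit_sum g n x}.
Proof.
move=> ig ga.
have iA n := integral_orbit_sum 0 n ig ga.
have mA n : measurable_fun setT (orbit_sum g n).
  by have [/integrableP[/measurable_EFinP]] := iA n.
have subA : subadditive_cocycle (orbit_sum g).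
  by move=> m n x _ _; rewrite orbit_sumD.
apply: ae_liminf_ge => // j.
have [//|P1] := liminf_le_01 (a - j.+1%:R^-1) mA (subadditive_cocycle_step subA).
have := liminf_le_mean subA mA (fun n _ => (iA n).1) _ P1.
move=> /(_ a) H; have : a <= a - j.+1%:R^-1.
  by apply: H => n _; rewrite (iA n).2 subn0.
by rewrite lerDl oppr_ge0 invr_le0 lern0.
Qed.

Lemma cvg_mean (u : nat -> R) (a : R) :
  (forall e, 0 < e -> \forall n \near \oo, n%:R * (a - e) <= u n) ->
  (forall e, 0 < e -> \forall n \near \oo, u n <= n%:R * (a + e)) ->
  u n / n%:R @[n --> \oo] --> a.
Proof.
move=> lo hi; apply/cvgrPdist_le => e e0; near=> n.
have n0 : 0 < n%:R :> R by rewrite ltr0n; near: n; exact: nbhs_infty_gt.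
rewrite distrC ler_distl ler_pdivlMr// ler_pdivrMr// ![_ * n%:R]mulrC.
by apply/andP; split; near: n; [exact: lo|exact: hi].
Unshelve. all: by end_near.
Qed.

(** Orbit sums are additive, so the lower bound also applies to - g and yields the upper bound. This
    symmetry is lost for a subadditive cocycle, where the upper bound needs the covering again. *)
Theorem birkhoff (g : X -> R) (a : R) :
  P.-integrable setT (EFin \o g) -> (\int[P]_x (g x)%:E = a%:E)%E ->
  {ae P, forall x, orbit_sum g n x / n%:R @[n --> \oo] --> a}.
Proof.
move=> ig ga.
have igN : P.-integrable setT (EFin \o (\- g)).
  by rewrite (_ : _ \o _ = \- (EFin \o g))%E//; exact: integrableN.
have gaN : (\int[P]_x ((\- g) x)%:E = (- a)%:E)%E.
  under eq_integral do rewrite EFinN.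
  by rewrite integralN ?ga// integrable_add_def.
apply: filterS2 (ae_orbit_sum_ge ig ga) (ae_orbit_sum_ge igN gaN) => x lo hi.
apply: cvg_mean => e e0; first by apply: filterS (lo e e0) => n /ltW.
apply: filterS (hi e e0) => n.
by rewrite /orbit_sum sumrN ltrNr -opprD mulrN opprK => /ltW.
Qed.
Lemma liminf_le_mono (f : nat -> X -> R) (c c' : R) : c <= c' ->
  liminf_le f c `<=` liminf_le f c'.
Proof.
move=> cc' x H k N; have [n nN fn] := H k N; exists n => //.
by rewrite (le_trans fn)// ler_wpM2l// lerD2r.
Qed.

(** The tail is a difference of two orbit sums. One third of e pays for the error of each, and one
    third for the main term N |b|. *)
Lemma orbit_tail (u : X -> R) (b e : R) (N : nat) (x : X) :
  0 < e -> orbit_sum u n x / n%:R @[n --> \oo] --> b ->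
  \forall n \near \oo, \sum_(n - N <= i < n) u (iter i S x) <= n%:R * e.
Proof.
move=> e0 ub.
have e30 : 0 < e / 3 by rewrite divr_gt0.
have B : \forall n \near \oo, `|orbit_sum u n x - n%:R * b| <= n%:R * (e / 3).
  move/cvgrPdist_le : ub => /(_ _ e30) ub; near=> n.
  have n0 : 0 < n%:R :> R by rewrite ltr0n; near: n; exact: nbhs_infty_gt.
  have : `|b - orbit_sum u n x / n%:R| <= e / 3 by near: n.
  rewrite distrC => H; rewrite -[n%:R in leRHS](gtr0_norm n0) -ler_pdivrMl ?normr_gt0 ?gt_eqF//.
  rewrite -normfV -normrM mulrBr mulrA mulVf ?gt_eqF// mul1r.
  by rewrite [_^-1 * _]mulrC.
have BN : \forall n \near \oo,
    `|orbit_sum u (n - N) x - (n - N)%:R * b| <= (n - N)%:R * (e / 3).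
  have [K _ BK] := B; exists (K + N)%N => // n /= Kn; apply: BK => /=; lia.
have [M M0 HM] := archi_mul_lt (N%:R * `|b|) e30.
near=> n.
have nN : (N <= n)%N by near: n; exact: nbhs_infty_ge.
have nM : (M <= n)%N by near: n; exact: nbhs_infty_ge.
have h1 : `|orbit_sum u n x - n%:R * b| <= n%:R * (e / 3) by near: n.
have h2 : `|orbit_sum u (n - N) x - (n - N)%:R * b| <= (n - N)%:R * (e / 3).
  by near: n.
have -> : \sum_(n - N <= i < n) u (iter i S x) = orbit_sum u n x - orbit_sum u (n - N) x.
  by rewrite /orbit_sum (@big_cat_nat _ _ _ (n - N)%N 0 n)//= ?leq_subr// addrAC subrr add0r.
have h3 : N%:R * `|b| <= n%:R * (e / 3).
  by rewrite (le_trans (ltW HM))// ler_wpM2r ?ler_nat// ltW.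
have h4 : (n - N)%:R * (e / 3) <= n%:R * (e / 3).
  by rewrite ler_wpM2r ?ler_nat ?leq_subr// ltW.
have h5 : N%:R * b <= N%:R * `|b| by rewrite ler_wpM2l// ler_norm.
move: h1 h2; rewrite !ler_distl natrB// => /andP[_ h1] /andP[h2 _].
move: h4 h2; rewrite natrB//; lra.
Unshelve. all: by end_near.
Qed.

Lemma ge0_cvge0 (v : nat -> \bar R) : (forall n, 0 <= v n)%E ->
  (forall e : R, 0 < e -> \forall n \near \oo, (v n <= e%:E)%E) ->
  v n @[n --> \oo] --> 0%E.
Proof.
move=> v0 H.
have fv e n : (v n <= e%:E)%E -> v n \is a fin_num.
  by move=> ve; rewrite ge0_fin_numE// (le_lt_trans ve)// ltry.
apply/fine_cvgP; split.
  by apply: filterS (H 1 ltr01) => n; exact: fv.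
apply/cvgrPdist_le => e e0; apply: filterS (H e e0) => n ve.
rewrite sub0r normrN ger0_norm ?fine_ge0//.
by rewrite -lee_fin fineK// (fv e).
Qed.

Theorem kingman (f : nat -> X -> R) :
  subadditive_cocycle f -> (forall n, measurable_fun setT (f n)) ->
  (forall n x, 0 <= f n x) -> P.-integrable setT (EFin \o f 1%N) ->
  exists l : R, {ae P, forall x, f n x / n%:R @[n --> \oo] --> l} /\
    (\int[P]_x (`|f n x / n%:R - l|)%:E)%E @[n --> \oo] --> 0%E.
Proof.
move=> fsub mf f0 if1.
have fin1 : (\int[P]_x (f 1%N x)%:E)%E \is a fin_num by exact: integrable_fin_num.
pose a := fine (\int[P]_x (f 1%N x)%:E)%E.
have fA n x : (0 < n)%N -> f n x <= orbit_sum (f 1%N) n x.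
  by move=> n0; exact: subadditive_sum.
have intf n : (0 < n)%N -> P.-integrable setT (EFin \o f n).
  move=> n0; have [iA _] := integral_orbit_sum 0 n if1 (esym (fineK fin1)).
  apply: le_integrable iA => //; first exact/measurable_EFinP.
  move=> x _ /=; rewrite lee_fin ger0_norm//.
  by rewrite (le_trans (fA _ _ n0))// ler_norm.
have step := subadditive_cocycle_step fsub.
(* By the zero-one law the infimum l of G is the almost sure value of liminf f_n / n. Birkhoff's
   theorem for f_1 puts a + 1 in G, and f >= 0 makes 0 a lower bound. *)
pose G := [set c | P (liminf_le f c) = 1%E].
have Gub : G (a + 1).
  apply: probability1_ae; first exact: measurable_liminf_le.
  apply: filterS (birkhoff if1 (esym (fineK fin1))) => x.
  move=> /cvgrPdist_le /(_ _ ltr01) H k N.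
  near \oo => n; exists n.
    by apply/andP; split; near: n; [exact: nbhs_infty_ge|exact: nbhs_infty_gt].
  have n0 : (0 < n)%N by near: n; exact: nbhs_infty_gt.
  have : `|a - orbit_sum (f 1%N) n x / n%:R| <= 1 by near: n.
  rewrite distrC ler_distl ler_pdivrMr ?ltr0n// => /andP[_ h].
  rewrite (le_trans (fA _ _ n0))// (le_trans h)// mulrC ler_wpM2l// lerDl.
  by rewrite invr_ge0.
have Glb : lbound G 0.
  move=> c Gc; rewrite leNgt; apply/negP => c0.
  have [k k0 kc] : exists2 k, (0 < k)%N & 1 < k%:R * (- c).
    by apply: archi_mul_lt; rewrite oppr_gt0.
  have [A0|/set0P[x Hx]] := eqVneq (liminf_le f c) set0.
    by move: Gc; rewrite /G /= A0 measure0 => /esym/eqP; rewrite onee_eq0.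
  have [n /andP[_ n0] fn] := Hx k.-1 0%N.
  have : 0 <= n%:R * (c + k.-1.+1%:R^-1) by exact: le_trans fn.
  rewrite pmulr_rge0 ?ltr0n// prednK// leNgt => /negP; apply.
  by rewrite -(opprK c) addrC subr_lt0 invf_plt ?posrE ?ltr0n ?oppr_gt0//
    -[(- c)^-1]mul1r ltr_pdivrMr// oppr_gt0.
have infG : has_inf G by split; [exists (a + 1)|exists 0].
pose l := inf G.
have l0 : 0 <= l by apply: lb_le_inf => //; exists (a + 1).
have lG c : l < c -> P (liminf_le f c) = 1%E.
  move=> lc; have [c' Gc' c'c] := inf_lt infG.1 lc.
  apply: probability1_ae; first exact: measurable_liminf_le.
  have aec := ae_probability1 (measurable_liminf_le c' mf) Gc'.
  by apply: filterS aec; exact: liminf_le_mono (ltW c'c).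
have lo : {ae P, forall x, forall e, 0 < e ->
    \forall n \near \oo, n%:R * (l - e) < f n x}.
  apply: ae_liminf_ge => // j.
  have [//|P1] := liminf_le_01 (l - j.+1%:R^-1) mf step.
  have : l <= l - j.+1%:R^-1 by apply: inf_lbound => //; exists 0.
  by rewrite lerDl oppr_ge0 invr_le0 lern0.
(* The five e's: one because the covering is applied at level l + e, one for its slack, two for the
   orbit sum of g (mean at most e, deviation at most e), one for the tail of u. *)
have hi1 e : 0 < e ->
    {ae P, forall x, \forall n \near \oo, f n x <= n%:R * (l + 5 * e)}.
  move=> e0.
  have Pc : P (liminf_le f (l + e)) = 1%E by apply: lG; rewrite ltrDl.
  have [N [u [g [iu ig [u0 g0] ge fle]]]] := cover_liminf fsub mf if1 Pc e0.
  have fing : (\int[P]_x (g x)%:E)%E \is a fin_num by exact: integrable_fin_num.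
  have finu : (\int[P]_x (u x)%:E)%E \is a fin_num by exact: integrable_fin_num.
  apply: filterS2 (birkhoff ig (esym (fineK fing)))
                  (birkhoff iu (esym (fineK finu))) => x.
  move=> /cvgrPdist_le /(_ _ e0) gx /(orbit_tail N e0) ux.
  near=> n.
  have n0 : (0 < n)%N by near: n; exact: nbhs_infty_gt.
  have n0' : 0 < n%:R :> R by rewrite ltr0n.
  have h1 : `|fine (\int[P]_x (g x)%:E)%E - orbit_sum g n x / n%:R| <= e by near: n.
  have h2 : \sum_(n - N <= i < n) u (iter i S x) <= n%:R * e by near: n.
  have h3 : fine (\int[P]_x (g x)%:E)%E <= e by rewrite -lee_fin fineK.
  have h4 := fle n x n0; rewrite -/(orbit_sum g n x) in h4.
  move: h1; rewrite distrC ler_distl ler_pdivrMr// => /andP[_ h1].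
  have h5 : orbit_sum g n x <= n%:R * (2 * e).
    by rewrite (le_trans h1)// mulrC ler_wpM2l// mulrDl mul1r lerD2r.
  move: h2 h4 h5; lra.
have hi : {ae P, forall x, forall e, 0 < e ->
    \forall n \near \oo, f n x <= n%:R * (l + e)}.
  have /ae_foralln : forall j, {ae P, forall x, \forall n \near \oo,
      f n x <= n%:R * (l + 5 * j.+1%:R^-1)} by move=> j; exact: hi1.
  apply: filterS => x H e e0.
  have [j j0 je] := archi_mul_lt 5 e0.
  apply: filterS (H j.-1) => n; move/le_trans; apply.
  rewrite ler_wpM2l// lerD2l prednK// ler_pdivrMr ?ltr0n// mulrC.
  exact: ltW.
have cvgf : {ae P, forall x, f n x / n%:R @[n --> \oo] --> l}.
  apply: filterS2 lo hi => x lo hi; apply: cvg_mean => // e e0.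
  by apply: filterS (lo e e0) => n /ltW.
exists l; split => //.
apply: ge0_cvge0 => [n|e e0]; first by apply: integral_ge0 => x _; rewrite lee_fin.
(* Convergence in mean rests on |t - l| = (t - l) + 2 max (l - t, 0) with t = f_n / n. Since f >= 0
   the maximum lies between 0 and l, so dominated convergence applies to it, and the mean of t - l
   is bounded above by the covering. *)
pose q n x := Num.max (l - f n x / n%:R) 0.
have q0 n x : 0 <= q n x by rewrite le_max lexx orbT.
have ql n x : q n x <= l by rewrite ge_max l0 lerBlDr lerDl divr_ge0.
have mq n : measurable_fun setT (q n).
  apply: measurable_maxr; last exact: measurable_cst.
  apply: measurable_funB; first exact: measurable_cst.
  by apply: measurable_funM => //; exact: measurable_cst.
have iq n : P.-integrable setT (EFin \o q n).
  apply: (@le_integrable _ _ _ _ _ measurableT _ (EFin \o cst l)).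
  - exact/measurable_EFinP.
  - by move=> x _ /=; rewrite lee_fin !ger0_norm.
  - exact: finite_measure_integrable_cst.
have intq : (\int[P]_x (q n x)%:E)%E @[n --> \oo] --> 0%E.
  have [|||||_ _] := @dominated_convergence _ _ _ P setT measurableT
    (fun n x => (q n x)%:E) (cst 0%E) (EFin \o cst l).
  - by move=> n; exact/measurable_EFinP.
  - exact: measurable_cst.
  - apply: filterS cvgf => x cx _; apply: cvg_EFin; first exact: nearW.
    apply/cvgrPdist_le => e' e'0.
    move/cvgrPdist_le : cx => /(_ _ e'0); apply: filterS => n; apply: le_trans.
    by rewrite sub0r normrN /= ger0_norm// ge_max ler_norm normr_ge0.
  - exact: finite_measure_integrable_cst.
  - by apply: aeW => x n _ /=; rewrite lee_fin ger0_norm.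
  by rewrite integral_cst// mul0e.
have e80 : 0 < e / 8 by rewrite divr_gt0.
have [C HC] : exists C : R, forall n, (0 < n)%N ->
    (\int[P]_x (f n x)%:E <= (n%:R * (l + e / 8 + e / 8) + C)%:E)%E.
  by apply: subadditive_mean_bound => //; apply: lG; rewrite ltrDl.
have [K K0 HK] := archi_mul_lt C e80.
move/fine_cvgP : intq => [_ /cvgrPdist_le /(_ _ e80) intq].
near=> n.
have n0 : (0 < n)%N by near: n; exact: nbhs_infty_gt.
have n0' : 0 < n%:R :> R by rewrite ltr0n.
have nK : (K <= n)%N by near: n; exact: nbhs_infty_ge.
have finq : (\int[P]_x (q n x)%:E)%E \is a fin_num.
  exact: (integrable_fin_num _ (iq n)).
have finf : (\int[P]_x (f n x)%:E)%E \is a fin_num.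
  exact: (integrable_fin_num _ (intf n n0)).
have hq : `|0 - fine (\int[P]_x (q n x)%:E)%E| <= e / 8 by near: n.
have -> : (\int[P]_x (`|f n x / n%:R - l|)%:E =
   \int[P]_x ((n%:R^-1)%:E * (f n x)%:E + ((- l)%:E + 2%:E * (q n x)%:E)))%E.
  apply: eq_integral => x _; rewrite -!EFinM -!EFinD; congr EFin.
  rewrite /q; move: (f n x / n%:R) (mulrC (n%:R^-1) (f n x)) => t ->.
  case: (leP (l - t) 0) => h.
    rewrite ger0_norm; lra.
  rewrite ltr0_norm; lra.
have i1 : P.-integrable setT (fun x => (n%:R^-1)%:E * (f n x)%:E)%E.
  by apply: integrableZl => //; exact: intf.
have i3 : P.-integrable setT (fun x => 2%:E * (q n x)%:E)%E.
  by apply: integrableZl => //; exact: iq.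
have i2 : P.-integrable setT (EFin \o cst (- l)) by exact: finite_measure_integrable_cst.
rewrite (integralD measurableT i1 (integrableD measurableT i2 i3)).
rewrite (integralD measurableT i2 i3) /= expectation_const.
rewrite (integralZl measurableT (intf n n0)) (integralZl measurableT (iq n)).
have := HC n n0; rewrite -(fineK finf) -(fineK finq) -!EFinM -!EFinD !lee_fin.
move: hq; rewrite sub0r normrN => /(le_trans (ler_norm _)) hq hf.
have hC : C <= n%:R * (e / 8).
  by rewrite (le_trans (ltW HK))// ler_wpM2r ?ler_nat// ltW.
have : n%:R^-1 * fine (\int[P]_x (f n x)%:E)%E <= l + e / 8 + e / 8 + e / 8.
  by rewrite ler_pdivrMl//; move: hf hC; lra.
lra.
Unshelve. all: by end_near.
Qed.
End ergodic.
(** * Independent sequences on path spaces *)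

Section image_measure.
Context d d' (X : measurableType d) (Y : measurableType d') (R : realType).
Variables (m : {measure set X -> \bar R}) (F : X -> Y).
Hypothesis mF : measurable_fun setT F.

(* [mF] is an argument so that the measure structure can be inferred. *)
Definition image_measure of measurable_fun setT F : set Y -> \bar R :=
  fun A => m (F @^-1` A).

Let image_measure0 : image_measure mF set0 = 0%E.
Proof. by rewrite /image_measure preimage_set0 measure0. Qed.

Let image_measure_ge0 A : (0 <= image_measure mF A)%E.
Proof. exact: measure_ge0. Qed.

Let image_measure_sigma_additive : semi_sigma_additive (image_measure mF).
Proof.
move=> B mB tB mUB; rewrite /image_measure preimage_bigcup.
apply: measure_semi_sigma_additive.
- by move=> n; rewrite -[X in measurable X]setTI; exact: mF.
- apply/trivIsetP => /= i j _ _ ij; rewrite -preimage_setI.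
  by move/trivIsetP : tB => /(_ _ _ _ _ ij) ->//; rewrite preimage_set0.
- by rewrite -preimage_bigcup -[X in measurable X]setTI; exact: mF.
Qed.

HB.instance Definition _ := isMeasure.Build _ _ _ (image_measure mF)
  image_measure0 image_measure_ge0 image_measure_sigma_additive.

End image_measure.

Section image_law.
Context d d' (X : measurableType d) (Y : measurableType d') (R : realType).
Variables (P : probability X R) (F : X -> Y).
Hypothesis mF : measurable_fun setT F.

Let F_mixin := isMeasurableFun.Build _ _ _ _ _ mF.
Let F_mfun : {mfun X >-> Y} := HB.pack F F_mixin.

Definition image_law : probability Y R := distribution P F_mfun.

Lemma image_lawE (A : set Y) : image_law A = P (F @^-1` A).
Proof. by []. Qed.

Lemma ae_image_law (Q : Y -> Prop) :
  {ae image_law, forall y, Q y} -> {ae P, forall x, Q (F x)}.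
Proof. exact: (@ae_image _ _ X Y R P image_law F mF (fun _ _ => erefl)). Qed.

Lemma ge0_integral_image_law (g : Y -> \bar R) :
  measurable_fun setT g -> (forall y, 0 <= g y)%E ->
  (\int[image_law]_y g y = \int[P]_x g (F x))%E.
Proof.
move=> mg g0; apply/esym.
exact: (@ge0_integral_image _ _ X Y R P image_law F mF (fun _ _ => erefl)).
Qed.

Lemma integrable_image_law (g : Y -> R) :
  image_law.-integrable setT (EFin \o g) -> P.-integrable setT (EFin \o (g \o F)).
Proof. exact: (@integrable_image _ _ X Y R P image_law F mF (fun _ _ => erefl)). Qed.

End image_law.

(** * Path spaces, shifts and cylinders *)

Section path_space_theory.
Context d (S : measurableType d).

Lemma measurable_coord (i : nat) : measurable_fun setT (fun w : path_space S => w i).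
Proof.
move=> _ B mB; apply: sub_sigma_algebra; exists i => //.
by exists B.
Qed.

(** Stated for an arbitrary set I of coordinates because the replayed chain is later tested against
    the coordinates up to a given time only. *)
Lemma measurable_to_coordinates d' (X : measurableType d') (F : X -> path_space S)
    (I : set nat) : (forall i, I i -> measurable_fun setT (fun x => F x i)) ->
  forall A, <<s coordinate_sets S I >> A -> measurable (F @^-1` A).
Proof.
move=> mF A sA; pose T := g_sigma_algebraType (coordinate_sets S I).
rewrite -[X in measurable X]setTI.
apply: (@measurability _ _ X T setT F (coordinate_sets S I)) sA => //.
move=> _ [_ [i Ii [B mB <-]] <-].
by rewrite !setTI; rewrite -[X in measurable X]setTI; exact: mF.
Qed.

Lemma measurable_to_path d' (X : measurableType d') (F : X -> path_space S) :
  (forall i, measurable_fun setT (fun x => F x i)) -> measurable_fun setT F.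
Proof.
by move=> mF _ A mA; rewrite setTI; apply: (measurable_to_coordinates (I := setT)) mA.
Qed.

Definition path_shift (w : path_space S) : path_space S := fun i => w i.+1.

Lemma iter_path_shift n w i : iter n path_shift w i = w (n + i)%N.
Proof. by elim: n w => [//|n IH] w; rewrite iterSr IH addSn. Qed.

Lemma measurable_path_shift : measurable_fun setT path_shift.
Proof. by apply: measurable_to_path => i; exact: measurable_coord. Qed.

Definition cylinder (n : nat) (B : nat -> set S) : set (path_space S) :=
  [set w | forall i, (i < n)%N -> B i (w i)].

Definition cylinders_upto n : set (set (path_space S)) :=
  [set A | exists2 B, (forall i, measurable (B i)) & A = cylinder n B].

Definition cylinders : set (set (path_space S)) := \bigcup_n cylinders_upto n.

Lemma cylinderI n m B B' : cylinder n B `&` cylinder m B' =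
  cylinder (maxn n m) (fun i => (if (i < n)%N then B i else setT) `&`
                                (if (i < m)%N then B' i else setT)).
Proof.
apply/seteqP; split => [w [H H'] i _|w H].
  by split; case: ifPn => // ilt; [exact: H|exact: H'].
split=> i ilt.
  by have [] := H i (leq_trans ilt (leq_maxl _ _)); rewrite ilt.
by have [_] := H i (leq_trans ilt (leq_maxr _ _)); rewrite ilt.
Qed.

Lemma setI_closed_cylinders_upto n : setI_closed (cylinders_upto n).
Proof.
move=> _ _ [B mB ->] [B' mB' ->]; rewrite cylinderI maxnn.
by eexists; last reflexivity; move=> i /=; case: ifP => _; exact: measurableI.
Qed.

Lemma setI_closed_cylinders : setI_closed cylinders.
Proof.
move=> _ _ [n _ [B mB ->]] [m _ [B' mB' ->]]; rewrite cylinderI.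
exists (maxn n m) => //; eexists; last reflexivity.
by move=> i /=; do 2 case: ifP => _; exact: measurableI.
Qed.

Lemma cylinder_setT n : cylinder n (fun=> setT) = setT.
Proof. by apply/seteqP; split. Qed.

Lemma coordinate_cylinder (I : set nat) A : coordinate_sets S I A ->
  exists i B, [/\ I i, measurable B &
    forall n, (i < n)%N -> A = cylinder n (fun j => if j == i then B else setT)].
Proof.
move=> [i Ii [B mB <-]]; exists i, B; split => // n ilt.
apply/seteqP; split => [w [_ Bw] j _|w H]; first by case: eqP => // ->.
by split => //; have := H i ilt; rewrite eqxx.
Qed.

Lemma measurable_if_eq (i j : nat) (B : set S) : measurable B ->
  measurable (if j == i then B else setT).
Proof. by case: ifP. Qed.

Lemma sigma_cylinders_upto n :
  <<s coordinate_sets S [set i | (i < n)%N] >> `<=` <<s cylinders_upto n >>.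
Proof.
apply: sub_sigma_algebra2 => A /coordinate_cylinder[i [B [ilt mB /(_ n ilt) ->]]].
by eexists; last reflexivity; move=> j /=; exact: measurable_if_eq.
Qed.

Lemma measurable_past n (A : set (path_space S)) :
  <<s coordinate_sets S [set i | (i < n)%N] >> A -> measurable A.
Proof.
have sub : <<s coordinate_sets S [set i | (i < n)%N] >> `<=` <<s coordinate_sets S setT >>.
  by apply: sub_sigma_algebra2 => C [i _ H]; exists i.
exact: sub.
Qed.

Lemma cylinder_past n B : (forall i, measurable (B i)) ->
  <<s coordinate_sets S [set i | (i < n)%N] >> (cylinder n B).
Proof.
move=> mB; pose T := g_sigma_algebraType (coordinate_sets S [set i | (i < n)%N]).
have -> : cylinder n B = \bigcap_i ((fun w : path_space S => w i) @^-1`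
    (if (i < n)%N then B i else setT)).
  apply/seteqP; split => w H i.
    by move=> _ /=; case: ifPn => // ilt; exact: H.
  by move=> ilt; have := H i I; rewrite /= ilt.
apply: (@bigcapT_measurable _ T) => i; case: ifPn => ilt; last first.
  by rewrite preimage_setT; exact: (@measurableT _ T).
by apply: sub_sigma_algebra; exists i => //; exists (B i) => //; rewrite setTI.
Qed.

Lemma measurable_cylinder n B : (forall i, measurable (B i)) ->
  measurable (cylinder n B).
Proof. by move=> mB; apply: measurable_past; exact: cylinder_past. Qed.

Lemma measurable_cylindersE : @measurable _ (path_space S) = <<s cylinders >>.
Proof.
apply/seteqP; split.
  apply: sub_sigma_algebra2 => A /coordinate_cylinder[i [B [_ mB /(_ i.+1 (ltnSn i)) ->]]].
  exists i.+1 => //.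
  by eexists; last reflexivity; move=> j /=; exact: measurable_if_eq.
apply: smallest_sub; first exact: sigma_algebra_measurable.
by move=> _ [n _ [B mB ->]]; exact: measurable_cylinder.
Qed.

End path_space_theory.

Arguments cylinder {d S}.
Arguments path_shift {d S}.

(** * Independence of past and future; ergodicity of the shift *)

Section iid.
Context d (S : measurableType d) (R : realType).
Variables (nu : probability S R) (P : probability (path_space S) R).

Definition iid_law := forall n (B : nat -> set S), (forall i, measurable (B i)) ->
  P (cylinder n B) = (\prod_(i < n) fine (nu (B i)))%:E.

Lemma iid_law_coord0 B : iid_law -> measurable B ->
  P [set w | B (w 0%N)] = nu B.
Proof.
move=> /(_ 1%N (fun=> B)) H mB.
rewrite big_ord1 fineK ?fin_num_measure// in H; rewrite -H//.
by congr (P _); apply/seteqP; split => [w Bw [|//] _ //|w]; apply.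
Qed.

(* The factors in [G] are replaced by measurable sets one coordinate at a
   time. *)
Lemma iid_law_pi_system (G : set (set S)) (g : (set S)^nat) :
  measurable = <<s G >> -> setI_closed G -> (forall i, G (g i)) ->
  \bigcup_k g k = setT ->
  (forall n (B : nat -> set S), (forall i, G (B i)) ->
    P (cylinder n B) = (\prod_(i < n) fine (nu (B i)))%:E) -> iid_law.
Proof.
move=> mG GI Gg gT H.
have Gm B : G B -> measurable B by move=> GB; rewrite mG; exact: sub_sigma_algebra.
(* Factors of index below k are arbitrary measurable sets; from k on they lie in [G]. Factors of
   index at least n do not affect the cylinder and are reset to [g 0] to meet this condition. *)
suff K k : forall n B, (forall i, measurable (B i)) ->
    (forall i, (k <= i)%N -> G (B i)) ->
    P (cylinder n B) = (\prod_(i < n) fine (nu (B i)))%:E.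
  move=> n B mB; pose B' i := if (i < n)%N then B i else g 0%N.
  have -> : cylinder n B = cylinder n B'.
    by apply/seteqP; split => w Bw i ilt; have := Bw i ilt; rewrite /B' ilt.
  rewrite (K n); first by congr EFin; apply: eq_bigr => i _; rewrite /B' ltn_ord.
    by move=> i; rewrite /B'; case: ifP => // _; exact: Gm.
  by move=> i ni; rewrite /B' ltnNge ni; exact: Gg.
elim: k => [|k IH] n B mB GB; first by apply: H => i; exact: GB.
have [nk|kn] := leqP n k.
  pose B' i := if (i < n)%N then B i else g 0%N.
  have -> : cylinder n B = cylinder n B'.
    by apply/seteqP; split => w Bw i ilt; have := Bw i ilt; rewrite /B' ilt.
  rewrite IH; first by congr EFin; apply: eq_bigr => i _; rewrite /B' ltn_ord.
    by move=> i; rewrite /B'; case: ifP => // _; exact: Gm.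
  by move=> i ki; rewrite /B' ltnNge (leq_trans nk ki); exact: Gg.
pose upd C i := if i == k then C else B i.
have mupd C : measurable C -> forall i, measurable (upd C i).
  by move=> mC i; rewrite /upd; case: ifP.
have mD : measurable (cylinder n (upd setT)).
  by apply: measurable_cylinder; exact: mupd.
have mk : measurable_fun setT (fun w : path_space S => w k) by exact: measurable_coord.
(* As functions of the k-th factor alone, both sides are finite measures on [S]; by the induction
   hypothesis they agree on the generating pi-system. *)
pose m1 : {measure set S -> \bar R} := image_measure (mrestr P mD) mk.
pose c := \prod_(i < n | i != Ordinal kn) fine (nu (B i)).
have c0 : 0 <= c by apply: prodr_ge0 => i _; rewrite fine_ge0.
pose m2 : {measure set S -> \bar R} := mscale (NngNum c0) nu.
have E1 C : P (cylinder n (upd C)) = m1 C.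
  rewrite /m1 /image_measure /mrestr; congr (P _); apply/seteqP; split => w Hw.
    split; first by have := Hw k kn; rewrite /upd eqxx.
    by move=> i ilt; have := Hw i ilt; rewrite /upd; case: ifP.
  move=> i ilt; have := Hw.2 i ilt; rewrite /upd; case: eqP => // -> _.
  exact: Hw.1.
have E2 C : measurable C -> (\prod_(i < n) fine (nu (upd C i)))%:E = m2 C.
  move=> mC; rewrite (bigD1 (Ordinal kn))//= /upd eqxx /m2 /mscale/= mulrC EFinM.
  rewrite fineK ?fin_num_measure//; congr (_%:E * _)%E.
  by apply: eq_bigr => i ik; rewrite ifN.
have -> : B = upd (B k).
  by apply/funext => i; rewrite /upd; case: eqP => // ->.
rewrite E1 E2//.
apply: (measure_unique G g mG GI Gg gT) => //.
- move=> C GC; have mC := Gm _ GC.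
  rewrite -E1 -E2// IH//; first exact: mupd.
  move=> i ki; rewrite /upd; case: eqP => [//|/eqP ik].
  by apply: GB; rewrite ltn_neqAle eq_sym ik.
- move=> j; rewrite -E1 (le_lt_trans (probability_le1 _ _)) ?ltry//.
  by apply: measurable_cylinder; apply: mupd; exact: Gm.
Qed.

Lemma path_measure_unique (m1 m2 : {measure set (path_space S) -> \bar R}) :
  (m1 setT < +oo)%E ->
  (forall n B, (forall i, measurable (B i)) -> m1 (cylinder n B) = m2 (cylinder n B)) ->
  forall A, measurable A -> m1 A = m2 A.
Proof.
move=> m1oo H; apply: (measure_unique (@cylinders _ S) (fun=> setT)) => //.
- exact: measurable_cylindersE.
- exact: setI_closed_cylinders.
- by move=> _; exists 0%N => //; exists (fun=> setT) => //; rewrite cylinder_setT.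
- by apply/seteqP; split => // x _; exists 0%N.
- by move=> _ [n _ [B mB ->]]; exact: H.
Qed.

Hypothesis iidP : iid_law.

Lemma cylinder_shift_indep n m B B' : (forall i, measurable (B i)) ->
  (forall i, measurable (B' i)) ->
  P (cylinder n B `&` iter n path_shift @^-1` (cylinder m B')) =
  (P (cylinder n B) * P (cylinder m B'))%E.
Proof.
move=> mB mB'; pose C i := if (i < n)%N then B i else B' (i - n)%N.
have mC i : measurable (C i) by rewrite /C; case: ifP.
have -> : cylinder n B `&` iter n path_shift @^-1` (cylinder m B') = cylinder (n + m) C.
  apply/seteqP; split => [w [H H'] i ilt|w H].
    rewrite /C; case: ltnP => ni; first exact: H.
    have := H' (i - n)%N; rewrite iter_path_shift subnKC//; apply.
    by rewrite ltn_subLR.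
  split => i ilt.
    by have := H i (leq_trans ilt (leq_addr _ _)); rewrite /C ilt.
  have := H (n + i)%N; rewrite ltn_add2l => /(_ ilt).
  by rewrite /C ltnNge leq_addr/= addKn iter_path_shift.
rewrite !iidP// -EFinM big_split_ord/=; congr (_ * _)%:E.
  by apply: eq_bigr => i _; rewrite /C ltn_ord.
by apply: eq_bigr => i _; rewrite /C ltnNge leq_addr/= addKn.
Qed.

Lemma measurable_iter_shift n : measurable_fun setT (iter n (@path_shift _ S)).
Proof.
apply: measurable_to_path => i; rewrite (_ : (fun _ => _) = fun w => w (n + i)%N).
  exact: measurable_coord.
by apply/funext => w; rewrite iter_path_shift.
Qed.

(** Two uniqueness arguments for measures: first the past event is a fixed cylinder and the future
    event B varies, then B is fixed and the past event varies. *)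
Lemma past_future_indep n A B :
  <<s coordinate_sets S [set i | (i < n)%N] >> A -> measurable B ->
  P (A `&` iter n path_shift @^-1` B) = (P A * P B)%E.
Proof.
move=> sA mB; have ms := measurable_iter_shift n.
have msB C : measurable C -> measurable (iter n (@path_shift _ S) @^-1` C).
  by move=> mC; rewrite -[X in measurable X]setTI; exact: ms.
have fin1 C : measurable C -> 0 <= fine (P C) by move=> _; rewrite fine_ge0.
have cyl D : (forall i, measurable (D i)) ->
    P (cylinder n D `&` iter n path_shift @^-1` B) = (P (cylinder n D) * P B)%E.
  move=> mD; have mcD := measurable_cylinder n mD.
  pose m1 : {measure set (path_space S) -> \bar R} := image_measure (mrestr P mcD) ms.
  pose m2 : {measure set (path_space S) -> \bar R} := mscale (NngNum (fin1 _ mcD)) P.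
  have E1 C : m1 C = P (cylinder n D `&` iter n path_shift @^-1` C).
    by rewrite /m1 /image_measure /mrestr setIC.
  have E2 C : m2 C = (P (cylinder n D) * P C)%E.
    by rewrite /m2 /= /mscale /= fineK// fin_num_measure.
  rewrite -E1 -E2; apply: path_measure_unique => //.
    by rewrite E1 (le_lt_trans (probability_le1 _ _)) ?ltry//;
      apply: measurableI => //; exact: msB.
  by move=> k D' mD'; rewrite E1 E2; exact: cylinder_shift_indep.
pose m1 : {measure set (path_space S) -> \bar R} := mrestr P (msB _ mB).
pose m2 : {measure set (path_space S) -> \bar R} := mscale (NngNum (fin1 _ mB)) P.
have E2 C : m2 C = (P C * P B)%E.
  by rewrite /m2 /= /mscale /= fineK ?fin_num_measure// muleC.
have -> : P (A `&` iter n path_shift @^-1` B) = m1 A by [].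
rewrite -E2.
apply: (@g_sigma_algebra_measure_unique _ _ _ (cylinders_upto n) _ (fun=> setT)) => //.
- by move=> _ [D mD ->]; exact: measurable_cylinder.
- by move=> _; exists (fun=> setT) => //; rewrite cylinder_setT.
- by apply/seteqP; split => // x _; exists 0%N.
- exact: setI_closed_cylinders_upto.
- by move=> _ [D mD ->]; rewrite E2; exact: cyl.
- move=> _; rewrite /m1 /= /mrestr setTI (le_lt_trans (probability_le1 _ _)) ?ltry//.
  exact: (msB _ mB).
- exact: sigma_cylinders_upto.
Qed.

Lemma iid_shift_preserving A : measurable A -> P (path_shift @^-1` A) = P A.
Proof.
move=> mA; have := @past_future_indep 1 setT A.
rewrite setTI probability_setT mul1e; apply => //.
exact: (@measurableT _ (g_sigma_algebraType (coordinate_sets S [set i | (i < 1)%N]))).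
Qed.

(* Kolmogorov's zero-one law: an invariant set is independent of itself. *)
Lemma iid_shift_ergodic A : measurable A -> path_shift @^-1` A = A ->
  P A = 0%E \/ P A = 1%E.
Proof.
move=> mA SA.
have fA : 0 <= fine (P A) by rewrite fine_ge0.
have SnA n : iter n path_shift @^-1` A = A.
  by elim: n => [//|n IH]; rewrite -[RHS]IH -[in RHS]SA.
pose m1 : {measure set (path_space S) -> \bar R} := mrestr P mA.
pose m2 : {measure set (path_space S) -> \bar R} := mscale (NngNum fA) P.
have E2 C : m2 C = (P C * P A)%E.
  by rewrite /m2 /= /mscale /= fineK ?fin_num_measure// muleC.
have : m1 A = m2 A.
  apply: path_measure_unique => //.
    by rewrite /m1 /= /mrestr setTI (le_lt_trans (probability_le1 _ _)) ?ltry.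
  move=> n B mB; have := past_future_indep (cylinder_past (n := n) mB) mA.
  by rewrite SnA E2 => <-.
rewrite E2 /m1 /= /mrestr setIid -[P A]fineK ?fin_num_measure// -EFinM => -[].
set a := fine _ => aa; have : a * (1 - a) = 0 by rewrite mulrBr mulr1 -aa subrr.
move/eqP; rewrite mulf_eq0 subr_eq0 => /orP[/eqP->|/eqP<-]; [left|right]; done.
Qed.
End iid.
(** * Random walks and the rate of escape *)

(** A random index with countably many values is handled fibre by fibre. This serves both for
    products in the countable group and for quantities evaluated at a stopping time. *)
Lemma measurable_fun_countable d d' (X : measurableType d) (Y : measurableType d')
    (I : Type) (F : X -> I) (K : I -> X -> Y) : countable [set: I] ->
  (forall i, measurable (F @^-1` [set i])) ->
  (forall i, measurable_fun setT (K i)) -> measurable_fun setT (fun x => K (F x) x).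
Proof.
move=> cI mF mK _ B mB; rewrite setTI.
have -> : (fun x => K (F x) x) @^-1` B =
    \bigcup_i (F @^-1` [set i] `&` (setT `&` K i @^-1` B)).
  apply/seteqP; split => [x Bx|x [i _ /= [<- []//]]].
  by exists (F x).
apply: countable_bigcupT_measurable => // i.
by apply: measurableI => //; exact: mK.
Qed.

(** * Laws on a countable group *)

Section countable_law.
Context (R : realType) (G : groupType).
Hypothesis cG : countable [set: G].

Lemma measurable_from_discrete d (Y : measurableType d) (phi : discrete_group G -> Y) :
  measurable_fun setT phi.
Proof. by []. Qed.

(** Empty sets are allowed because the injection into the integers may miss some values; finite
    groups are then covered as well. *)
Lemma countable_enum : exists2 E : nat -> set (discrete_group G),
  trivIset setT E /\ \bigcup_k E k = setT &
  forall k, E k = set0 \/ exists g, E k = [set g].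
Proof.
have /countable_injP[f finj] := cG.
exists (fun k => [set g | f g = k]).
  split; last by apply/seteqP; split => // g _; exists (f g).
  by move=> i j _ _ [g [/= <- <-]].
move=> k; have [[g fg]|H] := pselect (exists g, f g = k).
  right; exists g; apply/seteqP; split => [x /= fx|x /= -> //].
  by apply: finj; rewrite ?inE//; rewrite fx fg.
by left; apply/seteqP; split => // x /= fx; apply: H; exists x.
Qed.

Lemma ge0_integral_discrete d (X : measurableType d) (P : {measure set X -> \bar R})
    (F : X -> discrete_group G) (phi : G -> \bar R) :
  measurable_fun setT F -> (forall g, 0 <= phi g)%E ->
  (\int[P]_x phi (F x) = \esum_(g in [set: G]) (phi g * P (F @^-1` [set g])))%E.
Proof.
move=> mF phi0; have [E [tE UE] E01] := countable_enum.
have mFE k : measurable (F @^-1` E k) by rewrite -[X in measurable X]setTI; exact: mF.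
have UFE : \bigcup_k (F @^-1` E k) = setT by rewrite -preimage_bigcup UE.
have := @ge0_integral_bigcup _ _ _ P (fun k => F @^-1` E k) (fun x => phi (F x)) mFE.
rewrite UFE => /= ->.
- have U' : [set: G] = \bigcup_k E k by rewrite UE.
  rewrite U' esum_bigcupT//; last by move=> g; rewrite mule_ge0.
  rewrite nneseries_esumT; last by move=> k; exact: integral_ge0.
  apply: eq_esum => k _; have [Ek|[g Ek]] := E01 k; rewrite Ek.
    by rewrite preimage_set0 integral_set0 esum_set0.
  rewrite esum_set1 ?mule_ge0//.
  rewrite (eq_integral (cst (phi g))); first by rewrite integral_cst// -Ek.
  by move=> x; rewrite inE /= => ->.
- exact: (measurableT_comp (measurable_from_discrete phi) mF).
- by move=> x _; exact: phi0.
- move=> i j _ _ [x [Ei Ej]]; apply: tE => //; by exists (F x).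
Qed.

(** The empty set is included to obtain a pi-system: two distinct singletons are disjoint. *)
Definition points : set (set (discrete_group G)) :=
  [set A | A = set0 \/ exists g, A = [set g]].

Lemma sigma_points : @measurable _ (discrete_group G) = <<s points >>.
Proof.
apply/seteqP; split => [A _|A _ //].
have -> : A = \bigcup_(g : G) (if g \in A then [set g] else set0).
  apply/seteqP; split => [g Ag|x [g _]]; first by exists g => //; rewrite mem_set.
  by case: ifPn => // /set_mem Ag ->.
apply: (@countable_bigcupT_measurable _ (g_sigma_algebraType points)) => // g.
by apply: sub_sigma_algebra; case: ifP => _; [right; exists g|left].
Qed.

Lemma setI_closed_points : setI_closed points.
Proof.
move=> A B [->|[g ->]]; first by rewrite set0I; left.
move=> [->|[h ->]]; first by rewrite setI0; left.
have [<-|gh] := eqVneq g h; first by rewrite setIid; right; exists g.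
by left; apply/seteqP; split => // x /= [->] /eqP; rewrite (negbTE gh).
Qed.

Lemma iid_law_points (nu : probability (discrete_group G) R)
    (P : probability (path_space (discrete_group G)) R) (rho : G -> R) :
  (forall g, nu [set g] = (rho g)%:E) ->
  (forall n (h : nat -> G), P [set w | forall i, (i < n)%N -> w i = h i] =
    (\prod_(i < n) rho (h i))%:E) -> iid_law nu P.
Proof.
move=> nurho H; have [E [_ UE] E01] := countable_enum.
apply: (iid_law_pi_system sigma_points setI_closed_points (g := E)) => //.
move=> n B B01.
have [[i [ilt Bi]]|nB0] := pselect (exists i, (i < n)%N /\ B i = set0).
  have -> : cylinder n B = set0.
    by apply/seteqP; split => // w /(_ i ilt); rewrite Bi.
  by rewrite measure0 (bigD1 (Ordinal ilt))//= Bi measure0 mul0r.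
have {}B01 i : exists g, (i < n)%N -> B i = [set g].
  have [Bi|[g Bi]] := B01 i; last by exists g.
  by exists 1%g => ilt; exfalso; apply: nB0; exists i.
have [h hB] := choice B01.
have -> : cylinder n B = [set w | forall i, (i < n)%N -> w i = h i].
  apply/seteqP; split => w /= Hw i ilt; have := Hw i ilt; rewrite (hB i)//.
by rewrite H; congr EFin; apply: eq_bigr => i _; rewrite (hB i)// nurho.
Qed.

End countable_law.

(** * Existence of the rate of escape *)

Section random_walk_theory.
Context (R : realType) (G : groupType) (D : gauge G).
Hypothesis cG : countable [set: G].
Hypothesis subD : subadditive_gauge D.
Local Notation GG := (discrete_group G).

Definition increments (x : path_space GG) : path_space GG :=
  fun i => ((x i : G)^-1 * (x i.+1 : G))%g.

Fixpoint walk_pos (h : nat -> G) (n : nat) : G :=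
  if n is n'.+1 then (walk_pos h n' * h n')%g else 1%g.

Lemma walk_pos_increments x n : walk_pos (increments x) n = ((x 0%N : G)^-1 * (x n : G))%g.
Proof.
elim: n => [|n IH] /=; first by rewrite mulVg.
by rewrite IH /increments mulgA mulgK.
Qed.

Lemma walk_posD h m n :
  walk_pos h (m + n) = (walk_pos h m * walk_pos (fun i => h (m + i)%N) n)%g.
Proof.
elim: n => [|n IH]; first by rewrite addn0 mulg1.
by rewrite addnS /= IH mulgA.
Qed.

Lemma eq_walk_pos h h' n : (forall i, (i < n)%N -> h i = h' i) ->
  walk_pos h n = walk_pos h' n.
Proof.
elim: n => [//|n IH] H /=; rewrite H// IH// => i ilt.
by apply: H; exact: leq_trans ilt (leqnSn n).
Qed.

Lemma measurable_mul d (X : measurableType d) (f g : X -> GG) :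
  measurable_fun setT f -> measurable_fun setT g ->
  measurable_fun setT (fun x => (f x * g x)%g : GG).
Proof.
move=> mf mg; apply: (@measurable_fun_countable _ _ X GG G f (fun a x => (a * g x)%g)) => //.
  by move=> i; rewrite -[X in measurable X]setTI; exact: mf.
move=> i; exact: (measurableT_comp (measurable_from_discrete (fun b => (i * b)%g : GG)) mg).
Qed.

Lemma measurable_walk_pos d (X : measurableType d) (h : X -> nat -> G) n :
  (forall i, (i < n)%N -> measurable_fun setT (fun x => h x i : GG)) ->
  measurable_fun setT (fun x => walk_pos (h x) n : GG).
Proof.
elim: n => [|n IH] mh /=; first exact: measurable_cst.
apply: measurable_mul; last exact: mh.
by apply: IH => i ilt; apply: mh; exact: leq_trans ilt (leqnSn n).
Qed.

Lemma measurable_increments : measurable_fun setT increments.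
Proof.
apply: measurable_to_path => i; apply: measurable_mul; last exact: measurable_coord.
by apply: (measurableT_comp (measurable_from_discrete (fun b => (b : G)^-1%g : GG)));
  exact: measurable_coord.
Qed.

Lemma probability_setI1 d (X : measurableType d) (P : probability X R) (A B : set X) :
  measurable A -> measurable B -> P A = 1%E -> P (A `&` B) = P B.
Proof.
move=> mA mB PA; have mCA := measurableC mA.
have PC : P (~` A) = 0%E by rewrite probability_setC// PA subee.
have PBC : P (B `&` ~` A) = 0%E.
  apply/eqP; rewrite eq_le measure_ge0 andbT -PC.
  by rewrite le_measure ?inE//; exact: measurableI.
transitivity (P (B `&` ~` A) + P (B `&` A))%E; first by rewrite PBC add0e setIC.
rewrite -measureU//; [|exact: measurableI|exact: measurableI|].
  by rewrite -setIUr setvU setIT.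
by rewrite setIACA setICl setI0.
Qed.

Definition word_set n (h : nat -> G) : set (path_space GG) :=
  [set w | forall i, (i < n)%N -> w i = h i].

Lemma measurable_word_set n h : measurable (word_set n h).
Proof.
have -> : word_set n h = cylinder n (fun i => [set h i] : set GG) by [].
exact: measurable_cylinder.
Qed.

Lemma walk_law_start rho (Q : probability (path_space GG) R) :
  random_walk_law rho Q -> Q [set x | x 0%N = 1%g] = 1%E.
Proof.
move=> /(_ 0%N (fun=> 1%g)); rewrite big_ord0 => <-.
by congr (Q _); apply/seteqP; split => [x /= -> //|x []].
Qed.

Lemma measurable_start : measurable [set x : path_space GG | x 0%N = 1%g].
Proof.
rewrite -[X in measurable X]setTI.
exact: (measurable_coord 0%N measurableT (Y := [set (1%g : GG)])).
Qed.

Lemma walk_law_increments rho (Q : probability (path_space GG) R) n h :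
  random_walk_law rho Q ->
  Q (increments @^-1` word_set n h) = (\prod_(i < n) rho (h i))%:E.
Proof.
move=> QL; rewrite -QL -(probability_setI1 measurable_start _ (walk_law_start QL)).
  by congr (Q _); apply/seteqP; split.
by rewrite -[X in measurable X]setTI; apply: measurable_increments => //;
  exact: measurable_word_set.
Qed.

Lemma walk_law_marginal rho (Q : probability (path_space GG) R) :
  random_walk_law rho Q ->
  exists nu : probability GG R, forall g, nu [set g] = (rho g)%:E.
Proof.
move=> QL; have m0 : measurable_fun setT (fun x : path_space GG => increments x 0%N).
  exact: (measurableT_comp (measurable_coord 0%N) measurable_increments).
exists (image_law Q m0) => g; rewrite image_lawE.
have := walk_law_increments 1 (fun=> g) QL; rewrite big_ord1 => <-.
congr (Q _); apply/seteqP; split => [x /= xg [|//] _ //|x /= H].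
exact: (H 0%N isT).
Qed.

Lemma walk_law_iid rho (Q : probability (path_space GG) R) (nu : probability GG R) :
  random_walk_law rho Q -> (forall g, nu [set g] = (rho g)%:E) ->
  iid_law nu (image_law Q measurable_increments).
Proof.
move=> QL nurho; apply: (iid_law_points cG nurho) => n h.
by rewrite image_lawE -(walk_law_increments n h QL).
Qed.

Definition gauge_norm (g : G) : R := (gauge_fun D g)%:R.

(** The gauge of the position is a subadditive cocycle over the shift of the increments: x_{m+n} is
    x_m times the n-th position of the walk driven by the increments shifted by m. *)
Lemma iid_escape_rate (nu : probability GG R) (P : probability (path_space GG) R) :
  iid_law nu P ->
  P.-integrable setT (EFin \o (fun w : path_space GG => gauge_norm (w 0%N))) ->
  exists l : R,
  {ae P, forall w, gauge_norm (walk_pos w n) / n%:R @[n --> \oo] --> l} /\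
  (\int[P]_w (`|gauge_norm (walk_pos w n) / n%:R - l|)%:E)%E @[n --> \oo] --> 0%E.
Proof.
move=> iidP i0.
apply: (kingman (@measurable_path_shift _ GG) (iid_shift_preserving iidP) (iid_shift_ergodic iidP)
  (f := fun n w => gauge_norm (walk_pos w n))).
- move=> m n w _ _; rewrite walk_posD /gauge_norm -natrD ler_nat.
  rewrite (leq_trans (subD _ _))// leq_add2l.
  rewrite (@eq_walk_pos _ (iter m path_shift w))// => i _.
  by rewrite iter_path_shift.
- move=> n; apply: (measurableT_comp (measurable_from_discrete (gauge_norm : GG -> R))).
  by apply: measurable_walk_pos => i _; exact: measurable_coord.
- by move=> n w; rewrite ler0n.
- by apply: eq_integrable i0 => // w _ /=; rewrite mul1g.
Qed.

Lemma integrable_coord_norm rho (nu : probability GG R) (P : probability (path_space GG) R) :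
  (forall g, nu [set g] = (rho g)%:E) -> iid_law nu P -> finite_first_moment D rho ->
  P.-integrable setT (EFin \o (fun w : path_space GG => gauge_norm (w 0%N))).
Proof.
move=> nurho iidP fm; have mn := measurableT_comp
  (measurable_from_discrete (gauge_norm : GG -> R)) (@measurable_coord _ GG 0%N).
apply/integrableP; split; first exact/measurable_EFinP.
rewrite (ge0_integral_discrete cG P (phi := fun g => `|(gauge_norm g)%:E|%E) (@measurable_coord _ GG 0%N))//.
apply: le_lt_trans fm; rewrite le_eqVlt; apply/orP; left; apply/eqP.
apply: eq_esum => g _.
rewrite abse_EFin ger0_norm ?ler0n// EFinM -nurho; congr (_ * _)%E.
by rewrite -(iid_law_coord0 iidP).
Qed.

(** [escape_rate_law] quantifies over every realisation Q of the walk. All of them give the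
    increments the same law, so the constant found for one Q0 serves for all. *)
Theorem escape_rate_law_exists rho : finite_first_moment D rho ->
  exists l, escape_rate_law D rho (l : R).
Proof.
move=> fm.
have [[Q0 Q0L]|noQ] := pselect (exists Q : probability (path_space GG) R, random_walk_law rho Q);
  last by exists 0 => Q QL; exfalso; apply: noQ; exists Q.
have [nu nurho] := walk_law_marginal Q0L.
have iid0 := walk_law_iid Q0L nurho.
have [l [ael L1l]] := iid_escape_rate iid0 (integrable_coord_norm nurho iid0 fm).
exists l => Q QL; have iidQ := walk_law_iid QL nurho.
have imQ A : measurable A -> Q (increments @^-1` A) = image_law Q0 measurable_increments A.
  apply: (@path_measure_unique _ GG R (image_law Q measurable_increments)
    (image_law Q0 measurable_increments)) => [|n B mB].
    by apply: (@le_lt_trans _ _ 1%E); [exact: probability_le1|exact: ltry].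
  by transitivity (\prod_(i < n) fine (nu (B i)))%:E; [exact: iidQ|rewrite -iid0].
have ae1 := ae_probability1 measurable_start (walk_law_start QL).
have norm1 x : x 0%N = 1%g -> forall n, walk_pos (increments x) n = x n.
  by move=> x0 n; rewrite walk_pos_increments x0 invg1 mul1g.
have mw n : measurable_fun setT (fun w : path_space GG => (`|gauge_norm (walk_pos w n) / n%:R - l|)%:E).
  apply/measurable_EFinP; apply: (measurableT_comp (measurable_from_discrete
    ((fun g => `|gauge_norm g / n%:R - l|) : GG -> R))).
  by apply: measurable_walk_pos => i _; exact: measurable_coord.
split.
  have aeQ := ae_image measurable_increments imQ ael.
  apply: filterS2 ae1 aeQ => x /norm1 x0.
  by rewrite (_ : (fun n => _) = (fun n => gauge_norm (x n) / n%:R))//; apply/funext => n; rewrite x0.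
rewrite (_ : (fun n => _) = (fun n =>
  (\int[image_law Q0 measurable_increments]_w (`|gauge_norm (walk_pos w n) / n%:R - l|)%:E)%E))//.
apply/funext => n; rewrite -(ge0_integral_image measurable_increments imQ)//.
apply: ae_eq_integral => //.
- apply/measurable_EFinP; apply: (measurableT_comp (measurable_from_discrete
    ((fun g => `|gauge_norm g / n%:R - l|) : GG -> R))).
  exact: measurable_coord.
- exact: (measurableT_comp (mw n) measurable_increments).
- by apply: filterS ae1 => x /norm1 x0 _; rewrite x0.
Qed.

Lemma escape_rateP rho : finite_first_moment D rho ->
  escape_rate_law D rho (escape_rate D rho : R).
Proof. by move=> /escape_rate_law_exists; exact: xgetPex. Qed.

End random_walk_theory.
(** * Stopping times *)

Lemma ge0_integral_mrestr d (X : measurableType d) (R : realType)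
    (m : {measure set X -> \bar R}) (C : set X) (mC : measurable C) (g : X -> \bar R) :
  measurable_fun setT g -> (forall x, 0 <= g x)%E ->
  (\int[mrestr m mC]_x g x = \int[m]_(x in C) g x)%E.
Proof.
move=> mg g0.
have N0 : mrestr m mC (~` C) = 0%E by rewrite /mrestr setICl measure0.
rewrite (ge0_negligible_integral (measurableC mC) measurableT mg (fun x _ => g0 x) N0).
rewrite setTD setCK; apply: eq_measure_integral => A mA AC.
by rewrite /= /mrestr setIidl.
Qed.

(** * Strong Markov property and Wald's inequality *)

Section strong_markov.
Context d (Z : measurableType d) (R : realType).
Variables (nu : probability Z R) (P : probability (path_space Z) R).
Hypothesis iidP : iid_law nu P.
Local Notation past n := (<<s coordinate_sets Z [set i | (i < n)%N] >>).

(** The value 0 is reserved for a null event on which there is no genuine stopping; the conditions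
    on the past concern positive values only. *)
Variable sigma : path_space Z -> nat.
Hypothesis sigma_past : forall s, (0 < s)%N -> past s (sigma @^-1` [set s]).
Hypothesis sigma_gt0 : P [set z | (0 < sigma z)%N] = 1%E.

Lemma past_measurable n A : past n A -> measurable (A : set (path_space Z)).
Proof. exact: measurable_past. Qed.

Lemma measurable_sigma_gt0 : measurable [set z | (0 < sigma z)%N].
Proof.
have -> : [set z | (0 < sigma z)%N] = \bigcup_s (sigma @^-1` [set s.+1]).
  apply/seteqP; split => [z /= s0|z [s _ /= ->]//].
  by exists (sigma z).-1 => //=; rewrite prednK.
by apply: bigcupT_measurable => s; apply: past_measurable; exact: sigma_past.
Qed.

Lemma sigma_eq0E : sigma @^-1` [set 0%N] = ~` [set z | (0 < sigma z)%N].
Proof. by apply/seteqP; split => z /=; [move=> ->|move/negP; rewrite -eqn0Ngt => /eqP]. Qed.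

Lemma measurable_sigma_eq s : measurable (sigma @^-1` [set s]).
Proof.
case: s => [|s]; last by apply: past_measurable; exact: sigma_past.
by rewrite sigma_eq0E; apply: measurableC; exact: measurable_sigma_gt0.
Qed.

Lemma sigma_eq0 : P (sigma @^-1` [set 0%N]) = 0%E.
Proof. by rewrite sigma_eq0E probability_setC ?sigma_gt0 ?subee//; exact: measurable_sigma_gt0. Qed.

Lemma ae_sigma_gt0 : {ae P, forall z, (0 < sigma z)%N}.
Proof. exact: ae_probability1 measurable_sigma_gt0 sigma_gt0. Qed.

Definition stop_shift (z : path_space Z) : path_space Z := iter (sigma z) path_shift z.

Lemma measurable_stop_shift : measurable_fun setT stop_shift.
Proof.
apply: (@measurable_fun_countable _ _ _ _ nat sigma (fun s z => iter s path_shift z)) => //.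
  exact: measurable_sigma_eq.
by move=> s; exact: measurable_iter_shift.
Qed.

Lemma measurable_stop_shift_preimage E : measurable E -> measurable (stop_shift @^-1` E).
Proof. by move=> mE; rewrite -[X in measurable X]setTI; exact: measurable_stop_shift. Qed.

Lemma partition_sigma A : measurable A ->
  P A = (\sum_(0 <= s <oo) P (A `&` sigma @^-1` [set s]))%E.
Proof.
move=> mA; rewrite -measure_semi_bigcup.
- by congr (P _); apply/seteqP; split => [z Az|z [s _ []//]]; exists (sigma z).
- by move=> s; apply: measurableI => //; exact: measurable_sigma_eq.
- by move=> i j _ _ [z [[_ /= <-] [_ /= <-]]].
- by apply: bigcupT_measurable => s; apply: measurableI => //; exact: measurable_sigma_eq.
Qed.

(** The events of the sigma-algebra of the past before [sigma], tested at positive times. *)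
Definition stopped_event A := forall s, (0 < s)%N -> past s (sigma @^-1` [set s] `&` A).

(** On [sigma = s] the map [stop_shift] is the deterministic shift by s, so independence of past and
    future at time s applies piece by piece. *)
Theorem strong_markov A E : measurable A -> stopped_event A -> measurable E ->
  P (A `&` stop_shift @^-1` E) = (P A * P E)%E.
Proof.
move=> mA sA mE.
have mI : measurable (A `&` stop_shift @^-1` E).
  by apply: measurableI => //; exact: measurable_stop_shift_preimage.
rewrite (partition_sigma mI) (partition_sigma mA) -[P E]fineK ?fin_num_measure//.
rewrite muleC -nneseriesZl//; apply: eq_eseriesr => s _.
rewrite fineK ?fin_num_measure// muleC.
have -> : A `&` stop_shift @^-1` E `&` sigma @^-1` [set s] =
    sigma @^-1` [set s] `&` A `&` iter s path_shift @^-1` E.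
  by apply/seteqP; split => z /= => [[[Az Ez] <-]|[[<- Az] Ez]].
(* For s = 0 nothing is known about the past, but both sides vanish. *)
rewrite [A `&` _]setIC; case: s => [|s]; last exact: (past_future_indep iidP (sA _ _) mE).
have null B : measurable B -> P (sigma @^-1` [set 0%N] `&` B) = 0%E.
  move=> mB; apply/eqP; rewrite eq_le measure_ge0 andbT -sigma_eq0.
  have m0 := measurable_sigma_eq 0.
  by rewrite le_measure ?inE//; exact: measurableI.
by rewrite -setIA !null ?mul0e//; exact: measurableI.
Qed.

Section blocks.
Context d' (S : measurableType d') (F : path_space Z -> S).
Hypothesis mF : measurable_fun setT F.
Hypothesis F_stopped : forall B, measurable B -> stopped_event (F @^-1` B).

Definition blocks (z : path_space Z) : path_space S := fun k => F (iter k stop_shift z).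

Lemma measurable_blocks : measurable_fun setT blocks.
Proof.
apply: measurable_to_path => k; apply: (measurableT_comp mF).
elim: k => [|k IH]; first exact: measurable_id.
exact: (measurableT_comp measurable_stop_shift IH).
Qed.

(** The first block is decided by the stopped past, and the others are the blocks of the path after
    [stop_shift]; the strong Markov property splits off one factor at a time. *)
Lemma iid_blocks : iid_law (image_law P mF) (image_law P measurable_blocks).
Proof.
move=> n; elim: n => [|n IH] B mB.
  rewrite big_ord0 image_lawE (_ : _ @^-1` _ = setT) ?probability_setT//.
  by apply/seteqP; split.
pose E := blocks @^-1` cylinder n (fun i => B i.+1).
have mE : measurable E.
  rewrite -[X in measurable X]setTI; apply: measurable_blocks => //.
  exact: measurable_cylinder.
have -> : image_law P measurable_blocks (cylinder n.+1 B) =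
    P (F @^-1` B 0%N `&` stop_shift @^-1` E).
  have bS z i : blocks z i.+1 = blocks (stop_shift z) i by rewrite /blocks iterSr.
  congr (P _); apply/seteqP; split => [z H|z [H0 H] [|i] ilt //].
    by split; [exact: (H 0%N)|move=> i ilt; rewrite -bS; exact: (H i.+1)].
  by have := H i ilt; rewrite -bS.
rewrite strong_markov//; [|by rewrite -[X in measurable X]setTI; exact: mF|exact: F_stopped].
have PE : P E = (\prod_(i < n) fine (image_law P mF (B i.+1)))%:E.
  exact: IH (fun i => B i.+1) (fun i => mB i.+1).
rewrite PE big_ord_recl EFinM; congr (_ * _)%E.
by rewrite fineK//; exact: fin_num_measure.
Qed.

End blocks.

Lemma past_future_integral n (C : set (path_space Z)) (g : path_space Z -> \bar R) :
  past n C -> measurable_fun setT g -> (forall z, 0 <= g z)%E ->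
  (\int[P]_(z in C) g (iter n path_shift z) = P C * \int[P]_z g z)%E.
Proof.
move=> pC mg g0; have mC := past_measurable pC.
have ms := @measurable_iter_shift _ Z n.
rewrite -(ge0_integral_mrestr P mC)//; last exact: (measurableT_comp mg ms).
have fC : 0 <= fine (P C) by rewrite fine_ge0.
pose m2 : {measure set (path_space Z) -> \bar R} := mscale (NngNum fC) P.
rewrite (@ge0_integral_image _ _ _ _ _ _ m2 _ ms)//; last first.
  move=> A mA; transitivity (P (C `&` iter n path_shift @^-1` A)).
    by rewrite setIC.
  by rewrite (past_future_indep iidP pC mA) /m2 /= /mscale /= fineK ?fin_num_measure.
by rewrite /m2 ge0_integral_mscale//= fineK ?fin_num_measure.
Qed.

(* Wald: the set [i < sigma] only depends on the first [i] coordinates, up to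
   the null set [sigma = 0]. *)
Lemma wald_le (g : path_space Z -> R) (m e : R) :
  measurable_fun setT g -> (forall z, 0 <= g z) ->
  (\int[P]_z (g z)%:E = m%:E)%E -> (\int[P]_z (sigma z)%:R%:E = e%:E)%E ->
  (\int[P]_z (\sum_(0 <= i < sigma z) g (iter i path_shift z))%:E <= (e * m)%:E)%E.
Proof.
move=> mg g0 gm se.
pose C i : set (path_space Z) :=
  \bigcap_s (if (0 < s <= i)%N then ~` (sigma @^-1` [set s]) else setT).
have pC i : past i (C i).
  pose T := g_sigma_algebraType (coordinate_sets Z [set j | (j < i)%N]).
  apply: (@bigcapT_measurable _ T) => s; case: ifPn => [/andP[s0 si]|_]; last first.
    exact: (@measurableT _ T).
  apply: (@measurableC _ T).
  have sub : past s `<=` past i.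
    by apply: sub_sigma_algebra2 => A [j js H]; exists j => //; exact: leq_trans si.
  by apply: sub; exact: sigma_past.
have mC i : measurable (C i) by exact: past_measurable (pC i).
have inC i z : (i < sigma z)%N -> C i z.
  move=> isz s _; case: ifPn => // /andP[_ si] /= H.
  by move: isz; rewrite H ltnNge si.
have notinC i z : (0 < sigma z)%N -> C i z -> (i < sigma z)%N.
  move=> s0 /(_ (sigma z) I); case: ifPn => [_ /(_ erefl)//|].
  by rewrite s0/= -ltnNge.
have mgi i : measurable_fun setT (fun z => (g (iter i path_shift z))%:E).
  apply/measurable_EFinP; exact: (measurableT_comp mg (@measurable_iter_shift _ Z i)).
pose t i := (fun z => (g (iter i path_shift z))%:E) \_ (C i).
have t0 i z : (0 <= t i z)%E by rewrite /t patchE; case: ifP => _; rewrite ?lee_fin.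
have mt i : measurable_fun setT (t i).
  apply/(measurable_restrict _ (mC i) measurableT); rewrite setTI.
  exact: measurable_funTS.
have msum : measurable_fun setT
    (fun z => (\sum_(0 <= i < sigma z) g (iter i path_shift z))%:E).
  apply/measurable_EFinP.
  apply: (@measurable_fun_countable _ _ _ _ nat sigma
    (fun k z => \sum_(0 <= i < k) g (iter i path_shift z))) => //.
    exact: measurable_sigma_eq.
  move=> k; apply: measurable_sum => i.
  exact: (measurableT_comp mg (@measurable_iter_shift _ Z i)).
apply: (@le_trans _ _ (\int[P]_z (\sum_(0 <= i <oo) t i z))%E).
  apply: ge0_le_integral => //.
  - by move=> z _; rewrite lee_fin sumr_ge0.
  - exact: ge0_emeasurable_sum.
  - move=> z _; apply: le_trans (nneseries_lim_ge (sigma z) _); last by [].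
    rewrite -sumEFin big_nat [leRHS]big_nat; apply: lee_sum => i /andP[_ isz].
    by rewrite /t patchE mem_set//; exact: inC.
have m0 : 0 <= m.
  by rewrite -lee_fin -gm; apply: integral_ge0 => z _; rewrite lee_fin.
rewrite integral_nneseries//.
under eq_eseriesr => i _.
  rewrite -integral_mkcond (past_future_integral (g := EFin \o g))//; last first.
    exact/measurable_EFinP.
  rewrite gm muleC.
  over.
rewrite nneseriesZl// [(e * m)%R]mulrC EFinM lee_wpmul2l ?lee_fin//.
(* The indicators of i < sigma, summed over i < N, give min(N, sigma), so every partial sum of the
   probabilities of the [C i] is at most the mean of [sigma]. *)
apply: lime_le; first exact: is_cvg_nneseries.
apply: nearW => N.
rewrite (eq_bigr (fun i => \int[P]_z (\1_(C i) z)%:E)%E); last first.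
  by move=> i _; rewrite integral_indic// setIT.
rewrite -ge0_integral_sum//; last 1 first.
  by move=> i; apply/measurable_EFinP; exact: measurable_indic.
rewrite -se; apply: ae_ge0_le_integral => //.
- by move=> z _; apply: sume_ge0 => i _; rewrite lee_fin.
- by apply: emeasurable_sum => i; apply/measurable_EFinP; exact: measurable_indic.
- by apply/measurable_EFinP; apply: (@measurable_fun_countable _ _ _ _ nat sigma
    (fun k (_ : path_space Z) => k%:R : R)) => //; exact: measurable_sigma_eq.
apply: filterS ae_sigma_gt0 => z s0 _.
rewrite sumEFin lee_fin.
apply: (@le_trans _ _ (\sum_(0 <= i < N) ((i < sigma z)%N)%:R)).
  apply: ler_sum => i _; rewrite indicE ler_nat.
  by case: (boolP (z \in C i)) => // /set_mem /(notinC _ _ s0) ->.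
rewrite -natr_sum ler_nat (_ : (\sum_(0 <= i < N) (i < sigma z))%N = minn N (sigma z)) ?geq_minr//.
elim: N => [|N IH]; first by rewrite big_nil min0n.
by rewrite big_nat_recr//= IH; lia.
Qed.

End strong_markov.
Lemma ae_exists d (X : measurableType d) (R : realType) (P : probability X R)
    (Q : X -> Prop) : {ae P, forall x, Q x} -> exists x, Q x.
Proof.
move=> [N [mN N0 sub]]; apply: contrapT => noQ.
have NT : N = setT by apply/seteqP; split => // x _; apply: sub => /= Qx; apply: noQ; exists x.
have := probability_setT P; rewrite -NT; move: N0 => /= -> /esym/eqP.
by rewrite onee_eq0.
Qed.

Lemma iid_law_map d d' (Z : measurableType d) (S : measurableType d') (R : realType)
    (nu : probability Z R) (P : probability (path_space Z) R) (f : Z -> S)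
    (mf : measurable_fun setT f)
    (mF : measurable_fun setT (fun z : path_space Z => (fun i => f (z i)) : path_space S)) :
  iid_law nu P -> iid_law (image_law nu mf) (image_law P mF).
Proof.
move=> iidP n B mB.
transitivity (P (cylinder n (fun i => f @^-1` B i))); first by [].
by rewrite iidP// => i; rewrite -[X in measurable X]setTI; exact: mf.
Qed.

(** * Walks driven by independent increments *)

Section walk_of_increments.
Context (R : realType) (G : groupType) (D : gauge G).
Hypothesis cG : countable [set: G].
Hypothesis subD : subadditive_gauge D.
Local Notation GG := (discrete_group G).
Local Notation norm := (@gauge_norm R G D).

Definition walk_path (h : path_space GG) : path_space GG := fun n => walk_pos h n.

Lemma measurable_walk_path : measurable_fun setT walk_path.
Proof.
apply: measurable_to_path => n; apply: (measurable_walk_pos cG) => i _.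
exact: measurable_coord.
Qed.

Lemma walk_path_law (nu : probability GG R) (P : probability (path_space GG) R)
    (rho : G -> R) : (forall g, nu [set g] = (rho g)%:E) -> iid_law nu P ->
  random_walk_law rho (image_law P measurable_walk_path).
Proof.
move=> nurho iidP n h; rewrite image_lawE.
transitivity (P (cylinder n (fun i => [set h i] : set GG))).
  congr (P _); apply/seteqP; split => [w /= [_ H] i ilt|w H] /=.
    by have := H i ilt; rewrite /walk_path /= mulgA mulVg mul1g.
  by split=> // i ilt; have := H i ilt; rewrite /walk_path /= mulgA mulVg mul1g.
rewrite iidP//; congr EFin; apply: eq_bigr => i _.
by rewrite nurho.
Qed.

Lemma ae_escape_rate (nu : probability GG R) (P : probability (path_space GG) R)
    (rho : G -> R) : (forall g, nu [set g] = (rho g)%:E) -> iid_law nu P ->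
  finite_first_moment D rho ->
  {ae P, forall h, norm (walk_pos h n) / n%:R @[n --> \oo] --> escape_rate D rho}.
Proof.
move=> nurho iidP fm.
have [aeQ _] := escape_rateP cG subD fm (walk_path_law nurho iidP).
exact: ae_image_law aeQ.
Qed.

(** Time 0 is excluded because the gauge of the identity may be positive. *)
Lemma norm_walk_pos (h : nat -> G) n : (0 < n)%N ->
  norm (walk_pos h n) <= \sum_(0 <= i < n) norm (h i).
Proof.
case: n => [//|n] _; elim: n => [|n IH]; first by rewrite big_nat1 /= mul1g.
rewrite big_nat_recr//= (le_trans _ (lerD IH (lexx _)))//.
by rewrite /gauge_norm -natrD ler_nat.
Qed.

End walk_of_increments.

(** * The walk observed at iterated stopping times *)

Section stopped_walk.
Context (R : realType) (G : groupType) (D : gauge G).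
Hypothesis cG : countable [set: G].
Hypothesis subD : subadditive_gauge D.
Local Notation GG := (discrete_group G).
Local Notation norm := (@gauge_norm R G D).

Context d (Z : measurableType d).
Variables (nu : probability Z R) (P : probability (path_space Z) R).
Hypothesis iidP : iid_law nu P.
Local Notation past n := (<<s coordinate_sets Z [set i | (i < n)%N] >>).

Variable sigma : path_space Z -> nat.
Hypothesis sigma_past : forall s, (0 < s)%N -> past s (sigma @^-1` [set s]).
Hypothesis sigma_gt0 : P [set z | (0 < sigma z)%N] = 1%E.
Variable e : R.
Hypothesis sigma_mean : (\int[P]_z (sigma z)%:R%:E = e%:E)%E.

Variables (step : Z -> GG) (mu : G -> R).
Hypothesis mstep : measurable_fun setT step.
Hypothesis step_law : forall g, nu (step @^-1` [set g]) = (mu g)%:E.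
Hypothesis mu_moment : finite_first_moment D mu.

Local Notation theta := (stop_shift sigma).

Definition steps (z : path_space Z) : path_space GG := fun i => step (z i).

Lemma measurable_steps : measurable_fun setT steps.
Proof.
by apply: measurable_to_path => i; exact: (measurableT_comp mstep (measurable_coord i)).
Qed.

Definition stopped_pos (z : path_space Z) : GG := walk_pos (steps z) (sigma z).

Lemma step_lawE g : image_law nu mstep [set g] = (mu g)%:E.
Proof. exact: step_law. Qed.

Lemma measurable_walk_steps n : measurable_fun setT (fun z => walk_pos (steps z) n : GG).
Proof.
apply: (measurable_walk_pos cG) => i _.
exact: (measurableT_comp mstep (measurable_coord i)).
Qed.

Lemma measurable_stopped_pos : measurable_fun setT stopped_pos.
Proof.
apply: (@measurable_fun_countable _ _ _ _ nat sigma
  (fun s z => walk_pos (steps z) s : GG)) => //.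
  exact: measurable_sigma_eq sigma_past.
exact: measurable_walk_steps.
Qed.

(** On [sigma = s] the position is that of the walk at the fixed time s, which reads only the steps
    of index less than s. *)
Lemma stopped_pos_stopped B : measurable B -> stopped_event sigma (stopped_pos @^-1` B).
Proof.
move=> mB s s0; pose T := g_sigma_algebraType (coordinate_sets Z [set i | (i < s)%N]).
have -> : sigma @^-1` [set s] `&` stopped_pos @^-1` B =
    sigma @^-1` [set s] `&` ((fun z => walk_pos (steps z) s : GG) @^-1` B).
  by apply/seteqP; split => z /= [zs Bz]; split => //; move: Bz; rewrite /stopped_pos zs.
apply: (@measurableI _ T); first exact: sigma_past.
have : measurable_fun [set: T] (fun z : T => walk_pos (steps z) s : GG).
  apply: (measurable_walk_pos cG) => i ilt.
  apply: (measurableT_comp mstep) => _ C mC.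
  by apply: sub_sigma_algebra; exists i => //; exists C.
by move=> /(_ (@measurableT _ T) B mB); rewrite setTI.
Qed.

Definition stop_time (k : nat) (z : path_space Z) : nat :=
  (\sum_(0 <= i < k) sigma (iter i theta z))%N.

Lemma iter_stop_shift k z : iter k theta z = iter (stop_time k z) path_shift z.
Proof.
elim: k => [|k IH]; first by rewrite /stop_time big_nil.
by rewrite iterS {1}/stop_shift IH -iterD /stop_time big_nat_recr//= addnC -IH.
Qed.

(** This embeds one walk in the other: the product of the first k stopped positions is the original
    walk at time T_k, here [stop_time k z]. *)
Lemma walk_pos_blocks k z :
  walk_pos (blocks sigma stopped_pos z) k = walk_pos (steps z) (stop_time k z).
Proof.
elim: k => [|k IH]; first by rewrite /stop_time big_nil.
rewrite /= IH {2}/stop_time big_nat_recr//= -/(stop_time k z) walk_posD; congr (_ * _)%g.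
rewrite /blocks /stopped_pos; apply: eq_walk_pos => i _.
by rewrite /steps iter_stop_shift iter_path_shift.
Qed.

Lemma measurable_sigma : measurable_fun setT (sigma : path_space Z -> nat).
Proof.
by apply: (@measurable_fun_countable _ _ _ _ nat sigma (fun s _ => s)) => //;
  exact: measurable_sigma_eq sigma_past.
Qed.

Lemma sigma_stopped B : measurable B -> stopped_event sigma (sigma @^-1` B).
Proof.
move=> _ s s0; pose T := g_sigma_algebraType (coordinate_sets Z [set i | (i < s)%N]).
have [Bs|nBs] := pselect (B s).
  rewrite setIidl; first exact: sigma_past.
  by move=> z /= ->.
rewrite (_ : _ `&` _ = set0); first exact: (@measurable0 _ T).
by apply/seteqP; split => // z [/= ->].
Qed.

Lemma stop_shift_preserving A : measurable A -> P (theta @^-1` A) = P A.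
Proof.
move=> mA; rewrite -[LHS](_ : P (setT `&` theta @^-1` A) = _); last by rewrite setTI.
rewrite (strong_markov iidP sigma_past sigma_gt0)//; last first.
  by move=> s s0; rewrite setIT; exact: sigma_past.
by rewrite -[RHS]mul1e; congr (_ * _)%E; exact: probability_setT.
Qed.

(** [stop_shift] preserves P, so almost surely every summand of T_k is positive. The bound makes T_k
    tend to infinity and keeps it nonzero as a denominator. *)
Lemma stop_time_ge : {ae P, forall z, forall k, (k <= stop_time k z)%N}.
Proof.
have ae1 : {ae P, forall z, forall k, (0 < sigma (iter k theta z))%N}.
  apply: ae_foralln => k.
  exact: (ae_image (measurable_iter (measurable_stop_shift sigma_past) k)
    (iter_measure_preserving (measurable_stop_shift sigma_past) stop_shift_preserving k)
    (ae_sigma_gt0 sigma_past sigma_gt0)).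
apply: filterS ae1 => z H; elim => [//|k IH].
by rewrite /stop_time big_nat_recr//= -addn1 leq_add.
Qed.

(** Birkhoff's theorem is applied not to [stop_shift] but to the shift on the sequence of successive
    values of [sigma], which is ergodic because the sequence is i.i.d. *)
Lemma stop_time_mean : {ae P, forall z, (stop_time n z)%:R / n%:R @[n --> \oo] --> e}.
Proof.
have mb := measurable_blocks sigma_past measurable_sigma.
have iidb := iid_blocks iidP sigma_past sigma_gt0 measurable_sigma sigma_stopped.
pose u (w : path_space nat) : R := (w 0%N)%:R.
have mnat : measurable_fun setT (fun k : nat => k%:R : R) by [].
have mu0 : measurable_fun setT u.
  exact: (measurableT_comp mnat (measurable_coord 0%N)).
have imu : (\int[image_law P mb]_w (u w)%:E = e%:E)%E.
  rewrite ge0_integral_image_law//; first exact/measurable_EFinP.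
  by move=> w; rewrite lee_fin.
have iu : (image_law P mb).-integrable setT (EFin \o u).
  apply/integrableP; split; first exact/measurable_EFinP.
  rewrite (eq_integral (fun w => (u w)%:E)) ?imu ?ltry// => w _ /=.
  by rewrite ger0_norm.
have ae1 := birkhoff (@measurable_path_shift _ nat) (iid_shift_preserving iidb)
  (iid_shift_ergodic iidb) iu imu.
apply: filterS (ae_image_law ae1) => z.
rewrite (_ : (fun n => _) = (fun n => (stop_time n z)%:R / n%:R))//.
apply/funext => n; congr (_ / _); rewrite /orbit_sum /stop_time natr_sum.
by apply: eq_bigr => i _; rewrite /u iter_path_shift addn0.
Qed.

Definition stopped_law (g : G) : R := fine (P (stopped_pos @^-1` [set g])).

Lemma stopped_lawE g : image_law P measurable_stopped_pos [set g] = (stopped_law g)%:E.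
Proof.
rewrite /stopped_law fineK// fin_num_measure// -[X in measurable X]setTI.
exact: measurable_stopped_pos.
Qed.

Lemma measurable_norm : measurable_fun setT (norm : GG -> R).
Proof. by []. Qed.

Lemma stopped_law_weights : probability_weights stopped_law.
Proof.
split=> [g|]; first by rewrite fine_ge0.
transitivity (\int[P]_z (fun=> 1%:E) (stopped_pos z))%E.
  rewrite (ge0_integral_discrete cG P (phi := fun=> 1%:E) measurable_stopped_pos)//.
  by apply: eq_esum => g _; rewrite mul1e -stopped_lawE image_lawE.
exact: expectation_const.
Qed.

(** Subadditivity bounds the gauge of the stopped position by the sum of the gauges of the steps
    before [sigma], and Wald's inequality bounds the mean of that sum. *)
Lemma stopped_law_moment : finite_first_moment D stopped_law.
Proof.
have iids := iid_law_map mstep measurable_steps iidP.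
have i0 := integrable_coord_norm cG step_lawE iids mu_moment.
pose g (z : path_space Z) : R := norm (step (z 0%N)).
have ig : P.-integrable setT (EFin \o g) := integrable_image_law i0.
have fing : (\int[P]_z (g z)%:E)%E \is a fin_num by exact: (integrable_fin_num _ ig).
have /integrableP[/measurable_EFinP mg _] := ig.
have := wald_le iidP sigma_past sigma_gt0 mg (fun z => ler0n _ _) (esym (fineK fing)) sigma_mean.
move=> wald.
rewrite /finite_first_moment.
have -> : (\esum_(g in [set: G]) ((gauge_fun D g)%:R * stopped_law g)%:E =
    \int[P]_z (norm (stopped_pos z))%:E)%E.
  rewrite (ge0_integral_discrete cG P (phi := fun g => (norm g)%:E) measurable_stopped_pos)//.
    by apply: eq_esum => h _; rewrite EFinM -stopped_lawE image_lawE.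
  by move=> h; rewrite lee_fin.
apply: le_lt_trans (ltry (e * fine (\int[P]_z (g z)%:E)%E)).
apply: le_trans wald; apply: ae_ge0_le_integral => //.
- by move=> z _; rewrite lee_fin.
- by apply/measurable_EFinP; exact: (measurableT_comp measurable_norm measurable_stopped_pos).
- by move=> z _; rewrite lee_fin sumr_ge0.
- apply/measurable_EFinP; apply: (@measurable_fun_countable _ _ _ _ nat sigma
    (fun k z => \sum_(0 <= i < k) g (iter i path_shift z))) => //.
    exact: measurable_sigma_eq sigma_past.
  move=> k; apply: measurable_sum => i.
  exact: (measurableT_comp mg (@measurable_iter_shift _ Z i)).
- apply: filterS (ae_sigma_gt0 sigma_past sigma_gt0) => z s0 _.
  rewrite lee_fin (le_trans (norm_walk_pos R subD _ s0))//.
  by apply: ler_sum => i _; rewrite /g /= /steps iter_path_shift addn0.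
Qed.

Theorem stopped_walk_escape_rate :
  escape_rate D stopped_law = e * escape_rate D mu.
Proof.
have iids := iid_law_map mstep measurable_steps iidP.
have ae1 := ae_image_law
  (ae_escape_rate cG subD step_lawE iids mu_moment).
have mb := measurable_blocks sigma_past measurable_stopped_pos.
have iidb := iid_blocks iidP sigma_past sigma_gt0 measurable_stopped_pos stopped_pos_stopped.
have ae2 := ae_image_law
  (ae_escape_rate cG subD stopped_lawE iidb stopped_law_moment).
(* The two rates are constants, so a single path on which all four almost sure properties hold is
   enough to relate them. *)
have [z [[z1 z2] [z3 z4]]] := ae_exists (filterI (filterI ae1 ae2)
  (filterI stop_time_ge stop_time_mean)).
have Too : stop_time n z @[n --> \oo] --> \oo.
  apply/cvgnyPge => A; near=> n; apply: leq_trans (z3 n).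
  by near: n; exact: nbhs_infty_ge.
have z1T := cvg_comp _ _ Too z1.
have := cvgM z1T z4.
have -> : ((fun n => norm (walk_pos (steps z) n) / n%:R) \o stop_time ^~ z) \*
   (fun n => (stop_time n z)%:R / n%:R) = (fun n => norm (walk_pos (blocks sigma stopped_pos z) n) / n%:R).
  apply/funext => n; rewrite /= walk_pos_blocks.
  have [->|n0] := posnP n; first by rewrite invr0 !mulr0.
  have T0 : (stop_time n z)%:R != 0 :> R.
    by rewrite pnatr_eq0 -lt0n; exact: leq_trans n0 (z3 n).
  by rewrite mulrA divfK.
by move=> z5; rewrite (cvg_unique (@norm_hausdorff _ _) z2 (z5 _)) mulrC.
Unshelve. all: by end_near.
Qed.

End stopped_walk.
(** * The extended chain *)

Lemma iid_law_rectangles d d' (S : measurableType d) (S' : measurableType d')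
    (R : realType) (nu : probability (S * S')%type R)
    (P : probability (path_space (S * S')%type) R) :
  (forall n (A : nat -> set S) (B : nat -> set S'), (forall i, measurable (A i)) ->
     (forall i, measurable (B i)) ->
     P (cylinder n (fun i => A i `*` B i)) =
     (\prod_(i < n) fine (nu (A i `*` B i)))%:E) -> iid_law nu P.
Proof.
move=> H; pose rect : set (set (S * S')) :=
  [set A `*` B | A in (measurable : set (set S)) & B in (measurable : set (set S'))].
apply: (@iid_law_pi_system _ _ _ nu P rect (fun=> setT)).
- exact: measurable_prod_measurableType.
- move=> _ _ [A mA [B mB <-]] [A' mA' [B' mB' <-]]; rewrite -setXI.
  by exists (A `&` A'); [exact: measurableI|exists (B `&` B') => //; exact: measurableI].
- by move=> _; exists setT => //; exists setT => //; rewrite setXTT.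
- by apply/seteqP; split => // x _; exists 0%N.
- move=> n C rC.
  have /choice[AB HAB] : forall i, exists AB : set S * set S',
      [/\ measurable AB.1, measurable AB.2 & C i = AB.1 `*` AB.2].
    by move=> i; have [A mA [B mB <-]] := rC i; exists (A, B).
  have -> : C = (fun i => (AB i).1 `*` (AB i).2).
    by apply/funext => i; have [] := HAB i.
  by apply: H => i; have [] := HAB i.
Qed.

(** * Pairing consecutive terms of an i.i.d. sequence *)

Section iid_pairs.
Context d (Y : measurableType d) (R : realType).
Variables (nu : probability Y R) (P : probability (path_space Y) R).
Hypothesis iidP : iid_law nu P.
Local Notation Z := (Y * Y)%type.

(** Grouping consecutive terms supplies spare randomness from the sequence at hand, with no need to
    build a larger product space. *)
Definition pairs (y : path_space Y) : path_space Z := fun i => (y i.*2, y i.*2.+1).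

Lemma measurable_pairs : measurable_fun setT pairs.
Proof.
by apply: measurable_to_path => i; apply: measurable_fun_pair; exact: measurable_coord.
Qed.

Definition pair_law : probability Z R := image_law P
  (measurableT_comp (measurable_coord 0%N) measurable_pairs).

Lemma big_double (F : nat -> R) n :
  \prod_(i < n.*2) F i = \prod_(i < n) (F i.*2 * F i.*2.+1).
Proof.
elim: n => [|n IH]; first by rewrite !big_ord0.
by rewrite doubleS !big_ord_recr /= IH mulrA.
Qed.

Lemma pairs_cylinder n (A B : nat -> set Y) : (forall i, measurable (A i)) ->
  (forall i, measurable (B i)) ->
  P (pairs @^-1` cylinder n (fun i => A i `*` B i)) =
  (\prod_(i < n) (fine (nu (A i)) * fine (nu (B i))))%:E.
Proof.
move=> mA mB; pose C j := if odd j then B j./2 else A j./2.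
have mC j : measurable (C j) by rewrite /C; case: ifP.
have -> : pairs @^-1` cylinder n (fun i => A i `*` B i) = cylinder n.*2 C.
  apply/seteqP; split => [y H j jn|y H i ilt].
    have [] := H j./2; first by rewrite ltn_half_double.
    rewrite /= => HA HB; have jE := odd_double_half j.
    rewrite /C; case: ifP => jo; rewrite jo in jE.
      by have -> : y j = y j./2.*2.+1 by rewrite -[in LHS]jE.
    by have -> : y j = y j./2.*2 by rewrite -[in LHS]jE.
  split => /=.
    have := H i.*2; rewrite ltn_double => /(_ ilt).
    by rewrite /C odd_double doubleK.
  have := H i.*2.+1; rewrite ltn_Sdouble => /(_ ilt).
  by rewrite /C /= odd_double /= uphalf_double.
rewrite iidP// (big_double (fun j => fine (nu (C j)))); congr EFin; apply: eq_bigr => i _.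
by rewrite /C odd_double doubleK /= odd_double /= uphalf_double.
Qed.

Lemma pair_lawE (A B : set Y) : measurable A -> measurable B ->
  pair_law (A `*` B) = (fine (nu A) * fine (nu B))%:E.
Proof.
move=> mA mB; have := @pairs_cylinder 1 (fun=> A) (fun=> B) (fun=> mA) (fun=> mB).
rewrite big_ord1 => <-; congr (P _).
apply/seteqP; split => [y /= yAB [|//] _ //|y H /=].
exact: (H 0%N isT).
Qed.

Lemma iid_pairs : iid_law pair_law (image_law P measurable_pairs).
Proof.
apply: iid_law_rectangles => n A B mA mB.
transitivity (P (pairs @^-1` cylinder n (fun i => A i `*` B i))); first by [].
rewrite pairs_cylinder//; congr EFin; apply: eq_bigr => i _.
by rewrite pair_lawE.
Qed.

End iid_pairs.

(** * Replaying the extended chain from independent sources *)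

Section extended_chain.
Context (R : realType) (G : groupType).
Hypothesis cG : countable [set: G].
Local Notation GG := (discrete_group G).
Context d (Omega : measurableType d).
Variables (mu : G -> R) (theta : probability Omega R).
Variable P : probability (extended_path_space G Omega) R.
Hypothesis law : extended_chain_law mu theta P.
Local Notation E := (extended_path_space G Omega).
Local Notation Y := (GG * Omega)%type.
Local Notation Z := (Y * Y)%type.

(** omega_i is grouped with the increment leaving x_i. An event known at time s thus reads omega_s
    from innovation s, whose increment still lies in the future; [restart] below repairs this
    overlap. *)
Definition innovations (w : E) : path_space Y :=
  fun i => ((((w i).1 : G)^-1 * ((w i.+1).1 : G))%g, (w i).2).

Lemma measurable_innovations : measurable_fun setT innovations.
Proof.
have m1 i : measurable_fun setT (fun w : E => (w i).1).
  exact: (measurableT_comp measurable_fst (@measurable_coord _ Y i)).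
apply: measurable_to_path => i; apply: measurable_fun_pair.
  apply: (measurable_mul cG); last exact: m1.
  exact: (measurableT_comp (measurable_from_discrete (fun b => (b : G)^-1%g : GG)) (m1 i)).
exact: (measurableT_comp measurable_snd (@measurable_coord _ Y i)).
Qed.

Definition start : set E := [set w | (w 0%N).1 = 1%g].

Lemma measurable_start_ext : measurable start.
Proof.
rewrite -[X in measurable X]setTI.
apply: (measurableT_comp measurable_fst (@measurable_coord _ Y 0%N) measurableT
  (Y := [set (1%g : GG)])).
by [].
Qed.

Lemma start1 : P start = 1%E.
Proof.
have := law 0%N (fun=> 1%g) (fun=> measurableT); rewrite !big_ord0 mulr1 => <-.
by congr (P _); apply/seteqP; split => [x /= -> //|x []].
Qed.

Lemma innovations_law n (h : nat -> G) (A : nat -> set Omega) :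
  (forall i, measurable (A i)) ->
  P (innovations @^-1` cylinder n (fun i => [set (h i : GG)] `*` A i)) =
  (\prod_(i < n) (mu (h i) * fine (theta (A i))))%:E.
Proof.
move=> mA; rewrite big_split/= -law// -(probability_setI1 measurable_start_ext _ start1).
  congr (P _); apply/seteqP; split => [w [w0 H]|w [w0 H]]; split => //.
rewrite -[X in measurable X]setTI; apply: measurable_innovations => //.
by apply: measurable_cylinder => i; exact: measurableX.
Qed.

Definition innovation_law : probability Y R := image_law P
  (measurableT_comp (measurable_coord 0%N) measurable_innovations).

Lemma innovation_law_point g A : measurable A ->
  innovation_law ([set g] `*` A) = (mu g * fine (theta A))%:E.
Proof.
move=> mA; have := @innovations_law 1 (fun=> g) (fun=> A) (fun=> mA).
rewrite big_ord1 => <-; congr (P _).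
apply/seteqP; split => [y /= yAB [|//] _ //|y H /=].
exact: (H 0%N isT).
Qed.

Definition increment_law : probability GG R := image_law innovation_law measurable_fst.

Lemma increment_lawE g : increment_law [set g] = (mu g)%:E.
Proof.
transitivity (innovation_law ([set g] `*` setT)).
  by congr (innovation_law _); apply/seteqP; split => [x|x []].
rewrite innovation_law_point// (_ : fine (theta setT) = 1) ?mulr1//.
by rewrite (_ : theta setT = 1%E)//; exact: probability_setT.
Qed.

Lemma innovation_lawX (A : set GG) (B : set Omega) : measurable B ->
  innovation_law (A `*` B) = (fine (increment_law A) * fine (theta B))%:E.
Proof.
move=> mB; have mTB : measurable ([set: GG] `*` B) by exact: measurableX.
have fB : 0 <= fine (theta B) by rewrite fine_ge0.
pose m1 : {measure set GG -> \bar R} := image_measure (mrestr innovation_law mTB) measurable_fst.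
pose m2 : {measure set GG -> \bar R} := mscale (NngNum fB) increment_law.
have E1 C : m1 C = innovation_law (C `*` B).
  by rewrite /m1 /= /image_measure /mrestr; congr (innovation_law _);
    apply/seteqP; split => [x [Cx [_ Bx]]|x [Cx Bx]].
have E2 C : m2 C = (fine (increment_law C) * fine (theta B))%:E.
  have fC : increment_law C \is a fin_num by rewrite fin_num_measure.
  transitivity ((fine (theta B))%:E * increment_law C)%E; first by [].
  by rewrite -{1}(fineK fC) -EFinM mulrC.
rewrite -E1 -E2; have [F [_ UF] F01] := countable_enum cG.
apply: (measure_unique (@points G) F (sigma_points cG) (@setI_closed_points G)) => //.
- by move=> C [->|[g ->]]; rewrite ?measure0// E1 E2 innovation_law_point// increment_lawE.
- move=> k; rewrite E1; apply: (@le_lt_trans _ _ 1%E); last exact: ltry.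
  by apply: probability_le1; exact: measurableX.
Qed.

Lemma iid_innovations : iid_law innovation_law (image_law P measurable_innovations).
Proof.
have [F [_ UF] F01] := countable_enum cG.
pose rect : set (set Y) := [set A `*` B | A in @points G & B in (measurable : set (set Omega))].
apply: (@iid_law_pi_system _ _ _ _ _ rect (fun k => F k `*` setT)).
- rewrite measurable_prod_measurableType; apply/seteqP; split; last first.
    apply: sub_sigma_algebra2 => _ [A _ [B mB <-]].
    by exists A => //; exists B.
  apply: smallest_sub; first exact: smallest_sigma_algebra.
  move=> _ [A _ [B mB <-]].
  have -> : A `*` B = \bigcup_(g : G) ((if g \in A then [set g] else set0) `*` B).
    apply/seteqP; split => [[g b] [Ag Bb]|[g b] [g' _ [/= gA Bb]]].
      by exists g => //; split => //=; rewrite mem_set.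
    by move: gA; case: ifPn => // /set_mem Ag' ->.
  apply: (@countable_bigcupT_measurable _ (g_sigma_algebraType rect)) => // g.
  apply: sub_sigma_algebra.
  exists (if g \in A then [set g] else set0); last by exists B.
  by case: ifP => _; [right; exists g|left].
- move=> _ _ [A pA [B mB <-]] [A' pA' [B' mB' <-]]; rewrite -setXI.
  exists (A `&` A'); first exact: setI_closed_points.
  by exists (B `&` B') => //; exact: measurableI.
- by move=> k; exists (F k); [exact: F01|exists setT].
- apply/seteqP; split => // -[g b] _.
  have : (\bigcup_k F k) g by rewrite UF.
  by move=> [k _ Fg]; exists k.
move=> n C rC.
have [[i [ilt Ci]]|nC0] := pselect (exists i, (i < n)%N /\ C i = set0).
  rewrite (_ : cylinder n C = set0); last first.
    by apply/seteqP; split => // w /(_ i ilt); rewrite Ci.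
  by rewrite measure0 (bigD1 (Ordinal ilt))//= Ci measure0 mul0r.
have /choice[gB gBP] : forall i, exists gB : G * set Omega,
    measurable gB.2 /\ ((i < n)%N -> C i = [set (gB.1 : GG)] `*` gB.2).
  move=> i; have [A [A0|[g Ag]] [B mB CE]] := rC i; last first.
    by exists (g, B); split => // _; rewrite -CE Ag.
  exists (1%g, setT); split => [|ilt]; first exact: measurableT.
  exfalso; apply: nC0; exists i; split => //.
  by rewrite -CE A0 set0X.
have mB i : measurable (gB i).2 by have [] := gBP i.
transitivity (P (innovations @^-1` cylinder n (fun i => [set ((gB i).1 : GG)] `*` (gB i).2))).
  congr (P _); apply/seteqP; split => w H i ilt; have := H i ilt;
    by have [_ ->] := gBP i.
rewrite innovations_law//; congr EFin; apply: eq_bigr => i _.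
by have [_ ->//] := gBP i; rewrite innovation_law_point.
Qed.

Definition chain_path (y : path_space Y) : E :=
  fun i => (walk_pos (fun j => (y j).1 : G) i, (y i).2).

Lemma measurable_chain_path : measurable_fun setT chain_path.
Proof.
apply: measurable_to_path => i; apply: measurable_fun_pair.
  apply: (measurable_walk_pos cG) => j _.
  exact: (measurableT_comp measurable_fst (@measurable_coord _ Y j)).
exact: (measurableT_comp measurable_snd (@measurable_coord _ Y i)).
Qed.

Lemma chain_pathK w : start w -> chain_path (innovations w) = w.
Proof.
move=> w0; apply/funext => i.
transitivity (((w i).1, (w i).2) : Y); last by case: (w i).
congr pair; elim: i => [|i IH] /=; first by rewrite w0.
by rewrite IH /= mulgA mulgV mul1g.
Qed.

(* The source of randomness at time [i] is a pair of independent innovations: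
   the walk moves by the increment of the first one, and the extra variable of
   the second one is only used as the initial variable [omega_0] when the
   stopping procedure is restarted at time [i]. With this bookkeeping a stopping
   time at [s] only involves the sources of index less than [s]. *)
Definition restart (z : path_space Z) : path_space Y :=
  fun i => ((z i).1.1, if i is j.+1 then (z j).1.2 else (z 0%N).2.2).

Lemma measurable_restart : measurable_fun setT restart.
Proof.
have m1 i : measurable_fun setT (fun z : path_space Z => (z i).1).
  exact: (measurableT_comp measurable_fst (@measurable_coord _ Z i)).
have m2 i : measurable_fun setT (fun z : path_space Z => (z i).2).
  exact: (measurableT_comp measurable_snd (@measurable_coord _ Z i)).
apply: measurable_to_path => i; apply: measurable_fun_pair.
  exact: (measurableT_comp measurable_fst (m1 i)).
case: i => [|i]; first exact: (measurableT_comp measurable_snd (m2 0%N)).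
exact: (measurableT_comp measurable_snd (m1 i)).
Qed.

Definition source_law : probability Z R := pair_law (image_law P measurable_innovations).

Definition sources : probability (path_space Z) R :=
  image_law (image_law P measurable_innovations) (@measurable_pairs _ Y).

Lemma iid_sources : iid_law source_law sources.
Proof. exact: iid_pairs iid_innovations. Qed.

Lemma fine_theta1 : fine (theta setT) = 1.
Proof. by rewrite (_ : theta setT = 1%E)//; exact: probability_setT. Qed.

Lemma fine_increment1 : fine (increment_law setT) = 1.
Proof. by rewrite (_ : increment_law setT = 1%E)//; exact: probability_setT. Qed.

(** [restart] reads each independent component of the sources at most once, so rearranging the
    components across time preserves both independence and the marginal laws. *)
Lemma iid_restart : iid_law innovation_law (image_law sources measurable_restart).
Proof.
apply: iid_law_rectangles => n A B mA mB.
(* [B'] moves the constraint on omega_{j+1} to source j, and [B''] puts the constraint on omega_0 on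
   the spare variable of source 0. *)
pose B' j := if (j.+1 < n)%N then B j.+1 else setT.
pose B'' j := if j is 0%N then B 0%N else setT.
have mB' j : measurable (B' j) by rewrite /B'; case: ifP.
have mB'' j : measurable (B'' j).
  by case: j => [|j]; [exact: (mB 0%N)|exact: measurableT].
transitivity (sources (cylinder n (fun j => (A j `*` B' j) `*` ([set: GG] `*` B'' j)))).
  congr (sources _); apply/seteqP; split => [z H j jn|z H [|i] ilt].
  - split; split => //=; first by have [] := H j jn.
      by rewrite /B'; case: ifPn => // jn'; have [_] := H j.+1 jn'.
    by case: j jn => //= jn; have [_] := H 0%N jn.
  - by have [[/= ? _] [_ ?]] := H 0%N ilt.
  - have [[/= ? _] _] := H i.+1 ilt; split => //=.
    by have [[_ /=]] := H i (ltnW ilt); rewrite /B' ilt.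
rewrite iid_sources; last by move=> i; apply: measurableX; exact: measurableX.
congr EFin.
transitivity (\prod_(i < n) (fine (increment_law (A i)) * (fine (theta (B' i)) * fine (theta (B'' i))))).
  apply: eq_bigr => i _; rewrite /source_law (pair_lawE iid_innovations)//; do 2?[exact: measurableX].
  by rewrite !innovation_lawX//= fine_increment1 mul1r mulrA.
rewrite big_split /=.
transitivity ((\prod_(i < n) fine (increment_law (A i))) * \prod_(i < n) fine (theta (B i))).
  congr (_ * _); rewrite big_split /=.
  case: n @B' mB' => [|n] B' mB'; first by rewrite !big_ord0 mulr1.
  have -> : \prod_(i < n.+1) fine (theta (B' i)) = \prod_(i < n) fine (theta (B i.+1)).
    rewrite big_ord_recr /= {2}/B' ltnn fine_theta1 mulr1.
    by apply: eq_bigr => i _; rewrite /B' ltnS ltn_ord.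
  have -> : \prod_(i < n.+1) fine (theta (B'' i)) = fine (theta (B 0%N)).
    by rewrite big_ord_recl big1 ?mulr1// => i _; exact: fine_theta1.
  by rewrite mulrC [RHS]big_ord_recl.
by rewrite -big_split /=; apply: eq_bigr => i _; rewrite innovation_lawX.
Qed.

Definition replay (z : path_space Z) : E := chain_path (restart z).

Lemma measurable_replay : measurable_fun setT replay.
Proof. exact: (measurableT_comp measurable_chain_path measurable_restart). Qed.

(** The restarted sequence has the law of the innovations, and on the almost sure event [start] the
    chain is a function of its innovations. *)
Lemma replay_law A : measurable A -> sources (replay @^-1` A) = P A.
Proof.
move=> mA; pose B := chain_path @^-1` A.
have mB : measurable B by rewrite -[X in measurable X]setTI; exact: measurable_chain_path.
transitivity (P (innovations @^-1` B)).
  apply: (@path_measure_unique _ Y R (image_law sources measurable_restart)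
    (image_law P measurable_innovations)) => //.
    by apply: (@le_lt_trans _ _ 1%E); [exact: probability_le1|exact: ltry].
  move=> n C mC; transitivity (\prod_(i < n) fine (innovation_law (C i)))%:E.
    exact: iid_restart.
  by rewrite -iid_innovations.
have mIB : measurable (innovations @^-1` B).
  by rewrite -[X in measurable X]setTI; exact: measurable_innovations.
rewrite -(probability_setI1 measurable_start_ext mIB start1).
rewrite -(probability_setI1 measurable_start_ext mA start1).
congr (P _); apply/seteqP; split => w [w0 wA]; split => //.
  by move: wA; rewrite /B /= chain_pathK.
by rewrite /B /= chain_pathK.
Qed.

(** For i <= s, x_i reads the increments of the sources below i, and omega_i reads source i - 1, or
    source 0 when i = 0. The latter case is where s > 0 enters. *)
Lemma replay_past s A : (0 < s)%N -> path_sigma_algebra s A ->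
  <<s coordinate_sets Z [set i | (i < s)%N] >> (replay @^-1` A).
Proof.
move=> s0; pose T := g_sigma_algebraType (coordinate_sets Z [set i | (i < s)%N]).
have mc j : (j < s)%N -> measurable_fun [set: T] (fun z : T => z j).
  by move=> js _ B mB; apply: sub_sigma_algebra; exists j => //; exists B.
apply: (@measurable_to_coordinates _ Y _ T replay) => i /= si.
apply: measurable_fun_pair.
  apply: (measurable_walk_pos cG) => j ji.
  have js : (j < s)%N by exact: leq_trans ji si.
  exact: (measurableT_comp measurable_fst (measurableT_comp measurable_fst (mc j js))).
case: i si => [|i] si.
  exact: (measurableT_comp measurable_snd (measurableT_comp measurable_snd (mc 0%N s0))).
exact: (measurableT_comp measurable_snd (measurableT_comp measurable_fst (mc i si))).
Qed.

End extended_chain.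

(** * Transfer from the sources to the given chain and stopping time *)

Theorem theorem3p5 (R : realType) (G : groupType) (D : gauge G) (mu : G -> R)
    (d : measure_display) (Omega : measurableType d)
    (theta : probability Omega R)
    (P : probability (extended_path_space G Omega) R)
    (tau : extended_path_space G Omega -> \bar R) :
  countable [set: G] ->
  subadditive_gauge D ->
  probability_weights mu ->
  (entropy mu < +oo)%E ->
  finite_first_moment D mu ->
  lebesgue_space theta ->
  extended_chain_law mu theta P ->
  randomized_stopping_time P tau ->
  (stopping_expectation P tau < +oo)%E ->
  [/\ probability_weights (transformed_measure P tau),
      finite_first_moment D (transformed_measure P tau) &
      escape_rate D (transformed_measure P tau) =
      fine (stopping_expectation P tau) * escape_rate D mu].
Proof.
move=> cG subD mu1 _ fm _ law [mtau tauval taufin taupast] etau.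
have iidZ := iid_sources cG law.
have mrep := measurable_replay cG (d := d) (Omega := Omega).
have rlaw := replay_law cG law.
pose r := @replay G d Omega.
(* [fine] sends +oo to 0, so [sigma] is 0 exactly where the stopping time is infinite, and equals
   [tau] elsewhere. *)
pose sigma (z : path_space _) := Num.truncn (fine (tau (r z))).
have tauE z s : tau (r z) = s%:R%:E -> sigma z = s.
  by rewrite /sigma => -> /=; rewrite natrK.
have sigma_tau z : (0 < sigma z)%N -> tau (r z) = (sigma z)%:R%:E.
  have [ts|[s s0 ts]] := tauval (r z); rewrite /sigma ts /= ?natrK//.
  by rewrite truncn0.
have tau_sigma z : (tau (r z) < +oo)%E -> (0 < sigma z)%N.
  by have [->|[s s0 ts]] := tauval (r z); rewrite // (tauE _ _ ts).
have tau_fibers s : (0 < s)%N ->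
    sigma @^-1` [set s] = r @^-1` [set w | tau w = s%:R%:E].
  move=> s0; apply/seteqP; split => z /= => [zs|/tauE //].
  by rewrite sigma_tau zs.
have sigma_past s : (0 < s)%N ->
    <<s coordinate_sets _ [set i | (i < s)%N] >> (sigma @^-1` [set s]).
  by move=> s0; rewrite tau_fibers//; apply: (replay_past cG s0); exact: taupast.
have ae_sigma : {ae sources cG P, forall z, (0 < sigma z)%N}.
  by apply: filterS (ae_image mrep rlaw taufin) => z; exact: tau_sigma.
have sigma1 : sources cG P [set z | (0 < sigma z)%N] = 1%E.
  by apply: probability1_ae ae_sigma; exact: measurable_sigma_gt0 sigma_past.
have tau0 w : (0 <= tau w)%E.
  by have [->|[s _ ->]] := tauval w; rewrite ?le0y// lee_fin.
have fin_mean : stopping_expectation P tau \is a fin_num.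
  by rewrite ge0_fin_numE//; apply: integral_ge0 => w _.
have sigma_mean : (\int[sources cG P]_z (sigma z)%:R%:E =
    (fine (stopping_expectation P tau))%:E)%E.
  rewrite fineK// /stopping_expectation -(ge0_integral_image mrep rlaw mtau tau0).
  apply: ae_eq_integral => //.
  - apply/measurable_EFinP; apply: (@measurable_fun_countable _ _ _ _ nat sigma
      (fun k _ => k%:R : R)) => //.
    exact: measurable_sigma_eq sigma_past.
  - exact: (measurableT_comp mtau mrep).
  - by apply: filterS ae_sigma => z /sigma_tau ->.
pose step (z : (discrete_group G * Omega) * (discrete_group G * Omega)) : discrete_group G := z.1.1.
have mstep : measurable_fun setT step := measurableT_comp measurable_fst measurable_fst.
have step_law g : source_law cG P (step @^-1` [set g]) = (mu g)%:E.
  have -> : step @^-1` [set g] = ([set g] `*` setT) `*` setT.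
    by apply/seteqP; split => [z|z [[]]].
  rewrite (pair_lawE (iid_innovations cG law))//; last exact: measurableX.
  rewrite (innovation_law_point cG law)// (fine_theta1 theta) mulr1.
  rewrite (_ : innovation_law cG P setT = 1%E) ?mulr1//.
  exact: probability_setT.
have sw := stopped_law_weights cG (sources cG P) sigma_past mstep.
have sm := stopped_law_moment cG subD iidZ sigma_past sigma1 sigma_mean mstep step_law fm.
have se := stopped_walk_escape_rate cG subD iidZ sigma_past sigma1 sigma_mean mstep step_law fm.
(* The two laws live on different spaces. Pulling the event defining mu_tau back by [r] gives the
   stopped event intersected with [sigma > 0], which has probability one; where [sigma] is 0 the
   stopped position is e by default. *)
have <- : stopped_law (sources cG P) sigma step = transformed_measure P tau.
  apply/funext => g; rewrite /stopped_law /transformed_measure; congr fine.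
  set A := [set w | _].
  have rA : r @^-1` A = [set z | (0 < sigma z)%N] `&` (stopped_pos sigma step) @^-1` [set g].
    apply/seteqP; split => [z [s ts zg]|z [z0 zg]].
      have zs := tauE _ _ ts; split => /=.
        by apply: tau_sigma; rewrite ts ltry.
      by rewrite /stopped_pos zs.
    by exists (sigma z) => //; exact: sigma_tau.
  have mA : measurable A.
    have -> : A = \bigcup_s ([set w | tau w = s.+1%:R%:E] `&` [set w | (w s.+1).1 = g]).
      apply/seteqP; split => [w [s ts wg]|w [s _ [/= ts wg]]]; last by exists s.+1.
      have [toc|[s' s'0 ts']] := tauval w; first by move: ts; rewrite toc.
      have ss' : s = s' by move: ts; rewrite ts' => -[/eqP]; rewrite eqr_nat => /eqP.
      by exists s'.-1 => //=; rewrite prednK// -ss'.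
    apply: bigcupT_measurable => s; apply: measurableI.
      have sub : @path_sigma_algebra _ (discrete_group G * Omega)%type s.+1 `<=` measurable.
        by apply: sub_sigma_algebra2 => B [i _ H]; exists i.
      by apply: sub; exact: taupast.
    rewrite -[X in measurable X]setTI.
    exact: (measurableT_comp measurable_fst (@measurable_coord _ (discrete_group G * Omega)%type s.+1)
      measurableT (Y := [set (g : discrete_group G)])).
  have mstop : measurable (stopped_pos sigma step @^-1` [set g]).
    by rewrite -[X in measurable X]setTI; apply: (measurable_stopped_pos cG sigma_past mstep).
  by rewrite -rlaw// rA (probability_setI1 _ mstop sigma1)//; exact: measurable_sigma_gt0 sigma_past.
by split.
Qed.
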